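(* Consider the random asymptotically affine controlled branching process of the context. (1) Suppose that for some $p\ge2$, with $q:=p/2$, there is a finite constant $C$ such that $\mathbf E|\xi-m|^p<\infty$ and, for all $k\ge1$, $$\mathbf E[N(k)^q]+\mathbf E|N(k)-\lambda Ak|^p\le C(1+k^q),\qquad \mathbf P\{N(k)=0\}+\mathbf E[N(k)^{-q};N(k)>0]\le Ck^{-q}.$$ Then for every fixed $\varepsilon>0$ there is $C_\varepsilon<\infty$ with $$\mathcal R_n(\varepsilon)\le C_\varepsilon\,\mathbf E[X_n^{-q};X_n>0]\qquad\text{for all }n.$$ More generally, there is a finite constant $C$ such that for all $0<\varepsilon_n\le1$ and $K_n\ge1$, $$\mathcal R_n(\varepsilon_n)\le C\,\mathbf P(0<X_n\le K_n)+C\,\varepsilon_n^{-p}K_n^{-q}.$$ (2) Fix $\varepsilon>0$. Suppose there are $C_\varepsilon<\infty$ and $s_{\phi,\varepsilon},s_{D,\varepsilon},s_{\xi,\varepsilon},s_{0,\varepsilon}\in(0,1)$ such that for every $k\ge1$ $$\mathbf P\Bigl(\Bigl|\tfrac{N(k)}k-\lambda A\Bigr|>\varepsilon\Bigr)\le C_\varepsilon s_{\phi,\varepsilon}^k,\quad \mathbf P(|D(k)|>\varepsilon k)\le C_\varepsilon s_{D,\varepsilon}^k,$$ $$\mathbf P\Bigl(\Bigl|\tfrac1k\sum_{j=1}^k\xi_j-m\Bigr|>\varepsilon\Bigr)\le C_\varepsilon s_{\xi,\varepsilon}^k,\quad \mathbf P\{N(k)=0\}\le C_\varepsilon s_{0,\varepsilon}^k.$$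 Then for all $n$ $$\mathbf P(\mathcal B_{n,1}(\varepsilon))\le C_\varepsilon F_n^+(s_{\phi,\varepsilon}),\quad \mathbf P(\mathcal B_{n,2}(\varepsilon))\le C_\varepsilon F_n^+(s_{D,\varepsilon}),\quad \mathbf P(\mathcal B_{n,3}(\varepsilon))\le C_\varepsilon F_n^+(s_{0,\varepsilon})+C_\varepsilon H_n^+(s_{\xi,\varepsilon}).$$
   Context: Notation: $\mathbb N=\{1,2,\dots\}$, $\mathbb N_0=\{0,1,2,\dots\}$, $\mathbf E[Y;B]=\mathbf E[Y\mathbf 1_B]$. Model. $\xi_{n,j}$ ($n\ge0,j\ge1$) are i.i.d. copies of an $\mathbb N_0$-valued $\xi$ with mean $m:=\mathbf E\xi\in(0,\infty)$. The environmental marks $\mathcal E_n$, $n\ge0$, are i.i.d.; the marks, the offspring array and the $\mathbb N_0$-valued $X_0$ are independent. The mark $\mathcal E_n$ determines $A_n\in\mathbb N$, $B_n\in\mathbb N_0$ and a random map $C_n:\mathbb N_0\to\mathbb N_0$ with $C_n(0)=0$ (possibly dependent). The control is $\phi_n(k)=A_nC_n(k)+B_n$, $N_n:=\phi_n(X_n)$, and $X_{n+1}=\sum_{j=1}^{N_n}\xi_{n,j}$. A constant $\lambda\in(0,\infty)$ is fixed. Generic one-generation objects. $(A,B,C)$ has the law of a generation mark, $(\xi_j)_{j\ge1}$ is an independent copy of a row of the offspring array, $N(k):=AC(k)+B$, $D(k):=\sum_{j=1}^{N(k)}\xi_j-m\lambda Ak$. Events and functionals. $\mathcal B_{n,1}(\varepsilon):=\{X_n>0,\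 |N_n/X_n-\lambda A_n|>\varepsilon\}$; $\mathcal B_{n,2}(\varepsilon):=\{X_n>0,\ |X_{n+1}/X_n-m\lambda A_n|>\varepsilon\}$; $\mathcal B_{n,3}(\varepsilon)$ is the event that $X_n>0$ and either $N_n=0$, or $N_n>0$ and $|X_{n+1}/N_n-m|>\varepsilon$. $\mathcal R_n(\varepsilon):=\sum_{j=1}^3\mathbf P(\mathcal B_{n,j}(\varepsilon))$. For $s\in(0,1)$, $F_n^+(s):=\mathbf E[s^{X_n};X_n>0]$ and $H_n^+(s):=\mathbf E[s^{N_n};N_n>0]$. *)

(* Defs.v *)
From HB Require Import structures.
From mathcomp Require Import all_boot all_order all_algebra.
From mathcomp Require Import all_classical all_reals all_analysis.

Set Implicit Arguments.
Unset Strict Implicit.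
Unset Printing Implicit Defensive.

Import Order.TTheory GRing.Theory Num.Theory.
Import numFieldNormedType.Exports.

Local Open Scope classical_set_scope.
Local Open Scope ring_scope.

(** ** Independence and laws *)

Definition sigma_of {d d'} {T : measurableType d} {U : measurableType d'}
    {R : realType} {P : probability T R} {I : Type} (X : I -> {RV P >-> U}) :
    set (set T) :=
  <<s \bigcup_i preimage_set_system setT (X i) measurable >>.

Definition independent2 {d} {T : measurableType d} {R : realType}
    (P : probability T R) (F G : set (set T)) : Prop :=
  forall A B, F A -> G B -> P (A `&` B) = (P A * P B)%E.

(* The three classes are sigma-algebras in every use, so the pairwise product
   rules are the instances where one of the sets is setT. *)
Definition independent3 {d} {T : measurableType d} {R : realType}
    (P : probability T R) (F G H : set (set T)) : Prop :=
  forall A B D, F A -> G B -> H D ->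
    P (A `&` B `&` D) = (P A * P B * P D)%E.

Definition mutually_independent {d d'} {T : measurableType d}
    {U : measurableType d'} {R : realType} {P : probability T R} {I : eqType}
    (X : I -> {RV P >-> U}) : Prop :=
  forall (J : seq I) (B : I -> set U), uniq J ->
    (forall i, measurable (B i)) ->
    P (\bigcap_(i in [set` J]) (X i @^-1` B i))
    = (\prod_(i <- J) P (X i @^-1` B i))%E.

(* The two variables may live on different probability spaces. *)
Definition same_law {d1 d2 d'} {T1 : measurableType d1}
    {T2 : measurableType d2} {U : measurableType d'} {R : realType}
    {P1 : probability T1 R} {P2 : probability T2 R}
    (X : {RV P1 >-> U}) (Y : {RV P2 >-> U}) : Prop :=
  forall B, measurable B -> distribution P1 X B = distribution P2 Y B.

Definition iid_copies {d1 d2 d'} {T1 : measurableType d1}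
    {T2 : measurableType d2} {U : measurableType d'} {R : realType}
    {P1 : probability T1 R} {P2 : probability T2 R} {I : eqType}
    (X : I -> {RV P1 >-> U}) (Y : {RV P2 >-> U}) : Prop :=
  mutually_independent X /\ forall i, same_law (X i) Y.

(* E[Y; B] = E[Y 1_B] *)
Definition expectation_on {d} {T : measurableType d} {R : realType}
    (P : probability T R) (Y : T -> R) (B : set T) : \bar R :=
  ('E_P[fun w => (Y w * \1_B w)%R])%E.

(** ** The controlled branching process *)

(* How a mark e determines the multiplier A, the immigration B and the map C. *)
Record mark_maps {d} (M : measurableType d) := MarkMaps {
  mA : M -> nat;
  mB : M -> nat;
  mC : M -> nat -> nat;
  measurable_mA : measurable_fun setT mA;
  measurable_mB : measurable_fun setT mB;
  measurable_mC : forall k, measurable_fun setT (fun e => mC e k);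
  mA_gt0 : forall e, (0 < mA e)%N;
  mC0 : forall e, mC e 0%N = 0%N
}.

Definition control {d} {M : measurableType d} (mm : mark_maps M)
    (e : M) (k : nat) : nat :=
  (mA mm e * mC mm e k + mB mm e)%N.

(* The columns of the offspring array are numbered from 0, so that a sum over
   1 <= j <= N reads \sum_(j < N). *)
Record cbp_data {dT dM} {T : measurableType dT} {R : realType}
    (P : probability T R) (M : measurableType dM) := CbpData {
  mark : nat -> {RV P >-> M};
  offspring : nat -> nat -> {RV P >-> nat};
  init : {RV P >-> nat}
}.

Definition offspring_array {dT dM} {T : measurableType dT} {R : realType}
    {P : probability T R} {M : measurableType dM} (S : cbp_data P M)
    (ij : nat * nat) : {RV P >-> nat} :=
  offspring S ij.1 ij.2.

Record generation_data {dQ dM} {T : measurableType dQ} {R : realType}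
    (Q : probability T R) (M : measurableType dM) := GenerationData {
  gmark : {RV Q >-> M};
  goffspring : nat -> {RV Q >-> nat}
}.

(* xi is the reference offspring variable and G the generic generation; they
   live on an auxiliary probability space. *)
Definition cbp_model {dT dQ dM} {T : measurableType dT}
    {T' : measurableType dQ} {R : realType} {P : probability T R}
    {Q : probability T' R} {M : measurableType dM}
    (S : cbp_data P M) (G : generation_data Q M) (xi : {RV Q >-> nat}) : Prop :=
  [/\ iid_copies (offspring_array S) xi,
      iid_copies (mark S) (gmark G) &
      independent3 P (sigma_of (mark S)) (sigma_of (offspring_array S))
        (sigma_of (fun _ : unit => init S))] /\
  iid_copies (goffspring G) xi /\
  independent2 Q (sigma_of (fun _ : unit => gmark G))
    (sigma_of (goffspring G)).

Section process.
Context {dT dM} {T : measurableType dT} {R : realType} {P : probability T R}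
  {M : measurableType dM} (mm : mark_maps M) (S : cbp_data P M).

Definition An (n : nat) (w : T) : nat := mA mm (mark S n w).

Fixpoint Xn (n : nat) (w : T) : nat :=
  if n is n'.+1 then
    (\sum_(j < control mm (mark S n' w) (Xn n' w)) offspring S n' j w)%N
  else init S w.

Definition Nn (n : nat) (w : T) : nat := control mm (mark S n w) (Xn n w).

Definition event1 (lambda : R) (n : nat) (eps : R) : set T :=
  [set w | (0 < Xn n w)%N /\
    eps < `| (Nn n w)%:R / (Xn n w)%:R - lambda * (An n w)%:R |].

Definition event2 (m lambda : R) (n : nat) (eps : R) : set T :=
  [set w | (0 < Xn n w)%N /\
    eps < `| (Xn n.+1 w)%:R / (Xn n w)%:R - m * lambda * (An n w)%:R |].

Definition event3 (m : R) (n : nat) (eps : R) : set T :=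
  [set w | (0 < Xn n w)%N /\
    (Nn n w = 0%N \/
     (0 < Nn n w)%N /\ eps < `| (Xn n.+1 w)%:R / (Nn n w)%:R - m |)].

Definition bad_prob (m lambda : R) (n : nat) (eps : R) : \bar R :=
  (P (event1 lambda n eps) + P (event2 m lambda n eps)
   + P (event3 m n eps))%E.

Definition Fplus (n : nat) (s : R) : \bar R :=
  expectation_on P (fun w => s ^+ Xn n w) [set w | (0 < Xn n w)%N].

Definition Hplus (n : nat) (s : R) : \bar R :=
  expectation_on P (fun w => s ^+ Nn n w) [set w | (0 < Nn n w)%N].

End process.

Section generation.
Context {dQ dM} {T : measurableType dQ} {R : realType} {Q : probability T R}
  {M : measurableType dM} (mm : mark_maps M) (G : generation_data Q M).

Definition gA (w : T) : nat := mA mm (gmark G w).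

Definition gN (k : nat) (w : T) : nat := control mm (gmark G w) k.

Definition gD (m lambda : R) (k : nat) (w : T) : R :=
  (\sum_(j < gN k w) goffspring G j w)%:R - m * lambda * (gA w)%:R * k%:R.

End generation.

(* Main.v *)
Require Import Defs.
From mathcomp Require Import all_boot all_order all_algebra.
From mathcomp Require Import all_classical all_reals all_analysis.
From mathcomp Require Import measurable_realfun ring lra.

Import Order.TTheory GRing.Theory Num.Theory.
Import numFieldNormedType.Exports.

(* X_n is a function of the marks and of the offspring rows with index < n, hence
   independent of the n-th mark and the n-th row. So, given X_n = k, each bad
   event has the probability of its generic one-generation version started
   from k, and a bound g(k) for the latter gives E[g(X_n); X_n > 0]. In part (2)
   these bounds are the hypotheses, the last one being applied given N_n instead
   of X_n. In part (1) they come from Markov's inequality of order p and from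
   the Marcinkiewicz-Zygmund inequality E|S_n - nm|^p <= K n^(p/2), which follows
   by induction on n from
     |x + y|^p <= |x|^p + c(x) y + C (|x|^(p-2) y^2 + |y|^p),
   where the term linear in y has mean zero. *)

Local Open Scope classical_set_scope.
Local Open Scope ring_scope.

(** * Discrete random variables *)

(** No conditional expectation is formed. Everything in play is a natural number except the mark,
    and once k is fixed the mark matters only through A and N(k). Conditioning thus becomes slicing
    along countably many values: on {X_n = k} the control has a constant argument, on a slice of the
    coded mark the number of summands is constant, and the resulting identities are summed over the
    slices. The obstacle is to know that the n-th mark and row are still fresh on a slice. The
    predicate [free_of] is the invariant for this: it survives the use of a fresh coordinate and the
    recombination of slices, hence passes through sums with a random number of terms and, by
    induction, to X_n. X_0 is not a coordinate of the family; it starts that induction.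

    In the moment induction, |x|^(p-2) has lower order than |x|^p but is not the moment that the
    induction hypothesis controls. Splitting at x^2 = t with t proportional to n turns it into a
    factor 1 + O(1/n) and a summand O(n^(p/2-1)), and both fit into the growth of n^(p/2). *)

Section discrete.
Context {d} {T : measurableType d} {R : realType} (P : probability T R).
Local Open Scope ereal_scope.

Lemma measurable_from_nat {d'} {U : measurableType d'} (h : nat -> U) :
  measurable_fun setT h.
Proof. by []. Qed.

Lemma measurable_nat_preimage (f : T -> nat) (b : set nat) :
  measurable_fun setT f -> measurable (f @^-1` b).
Proof. by move=> mf; rewrite -[X in measurable X]setTI; exact: mf. Qed.

Lemma bigcup_preimage_nat (f : T -> nat) (E : set T) :
  E = \bigcup_k (E `&` f @^-1` [set k]).
Proof.
by apply/seteqP; split=> [w Ew|w [k _ []]]//; exists (f w).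
Qed.

Lemma trivIset_preimage_nat (f : T -> nat) (E : set T) :
  trivIset setT (fun k => E `&` f @^-1` [set k]).
Proof. by move=> i j _ _ [w [[_ /= <-] [_ /= <-]]]. Qed.

(** Sums with a random number of terms are measurable by this: on each of the countably many slices
    {f = k} the index is constant. *)
Lemma measurable_nat_comp {d'} {U : measurableType d'} (f : T -> nat)
    (h : nat -> T -> U) : measurable_fun setT f ->
  (forall k, measurable_fun setT (h k)) ->
  measurable_fun setT (fun w => h (f w) w).
Proof.
move=> mf mh _ B mB; rewrite setTI (bigcup_preimage_nat f (_ @^-1` _)).
apply: bigcup_measurable => k _.
rewrite (_ : _ `&` _ = h k @^-1` B `&` f @^-1` [set k]).
  apply: measurableI; last exact: measurable_nat_preimage.
  by rewrite -[X in measurable X]setTI; exact: mh.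
by apply/seteqP; split=> w [/= + fk]; rewrite fk.
Qed.

Lemma measurable_nat_comp2 {d'} {U : measurableType d'} (f g : T -> nat)
    (h : nat -> nat -> U) : measurable_fun setT f -> measurable_fun setT g ->
  measurable_fun setT (fun w => h (f w) (g w)).
Proof.
move=> mf mg; apply: (measurable_nat_comp f (fun k w => h k (g w))) => // k.
exact: (measurableT_comp (measurable_from_nat (h k)) mg).
Qed.

Definition partial_sum (X : nat -> T -> nat) (c : nat) (w : T) : nat :=
  (\sum_(j < c) X j w)%N.

Lemma measurable_partial_sum (X : nat -> T -> nat) (c : nat) :
  (forall j, measurable_fun setT (X j)) ->
  measurable_fun setT (partial_sum X c).
Proof.
move=> mX; elim: c => [|c IH].
  rewrite /partial_sum; under eq_fun do rewrite big_ord0.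
  exact: measurable_cst.
rewrite /partial_sum; under eq_fun do rewrite big_ord_recr/=.
exact: (measurable_nat_comp2 _ _ addn).
Qed.

Lemma prob_partition (f : T -> nat) (E : set T) :
  measurable_fun setT f -> measurable E ->
  P E = \sum_(k <oo) P (E `&` f @^-1` [set k]).
Proof.
move=> mf mE; have mI k : measurable (E `&` f @^-1` [set k]).
  by apply: measurableI => //; exact: measurable_nat_preimage.
rewrite [X in P X](bigcup_preimage_nat f) measure_semi_bigcup//.
  exact: trivIset_preimage_nat.
exact: bigcup_measurable.
Qed.

Lemma ge0_integral_partition (f : T -> nat) (g : T -> \bar R) :
  measurable_fun setT f -> measurable_fun setT g -> (forall w, 0 <= g w) ->
  \int[P]_w g w = \sum_(k <oo) \int[P]_(w in f @^-1` [set k]) g w.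
Proof.
move=> mf mg g0.
have -> : [set: T] = \bigcup_k (f @^-1` [set k]).
  by rewrite [LHS](bigcup_preimage_nat f); under eq_bigcupr do rewrite setTI.
apply: ge0_integral_bigcup => //.
- by move=> k; exact: measurable_nat_preimage.
- exact: measurable_funTS.
- by move=> i j _ _ [w [/= <- <-]].
Qed.

Lemma ge0_integral_nat (f : T -> nat) (h : nat -> \bar R) :
  measurable_fun setT f -> (forall k, 0 <= h k) ->
  \int[P]_w h (f w) = \sum_(k <oo) h k * P (f @^-1` [set k]).
Proof.
move=> mf h0; rewrite (ge0_integral_partition f)//; last first.
  exact: (measurableT_comp (measurable_from_nat h) mf).
apply: eq_eseriesr => k _.
rewrite (eq_integral (fun=> h k)) ?integral_cst//.
  exact: measurable_nat_preimage.
by move=> w; rewrite inE /= => ->.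
Qed.

(** The last hypothesis says P(E | f = k) <= h k with the conditional probability multiplied out, so
    slices of probability zero need no convention. *)
Lemma prob_le_integral (f : T -> nat) (E : set T) (h : nat -> \bar R) :
  measurable_fun setT f -> measurable E -> (forall k, 0 <= h k) ->
  (forall k, P (E `&` f @^-1` [set k]) <= h k * P (f @^-1` [set k])) ->
  P E <= \int[P]_w h (f w).
Proof.
move=> mf mE h0 Eh; rewrite (prob_partition f)// ge0_integral_nat//.
exact: lee_nneseries.
Qed.

Lemma prob_le_integral_ge1 (E : set T) (g : T -> \bar R) :
  measurable E -> measurable_fun setT g -> (forall w, 0 <= g w) ->
  (forall w, E w -> 1 <= g w) -> P E <= \int[P]_w g w.
Proof.
move=> mE mg g0 g1; rewrite -[E]setIT -integral_indic//.
apply: ge0_le_integral => //.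
- by apply/measurable_EFinP; exact: measurable_indic.
- move=> w _; rewrite indicE; case: (boolP (w \in E)) => [|_] //.
  by rewrite inE => /g1.
Qed.

Lemma nneseriesZ_prob (Z : set T) (a : nat -> \bar R) : measurable Z ->
  (forall k, 0 <= a k) ->
  \sum_(k <oo) (P Z * a k) = P Z * \sum_(k <oo) a k.
Proof.
move=> mZ a0; rewrite -(fineK (fin_num_measure P _ mZ)).
by rewrite nneseriesZl.
Qed.

(** Weaker than joint independence: each term is only compared with the sum of its predecessors.
    This is what the convolution formula [prob_sum_recr] and the moment recursion consume. *)
Definition independent_increments (X : nat -> T -> nat) := forall c k b,
  P (partial_sum X c @^-1` [set k] `&` X c @^-1` b) =
  P (partial_sum X c @^-1` [set k]) * P (X c @^-1` b).

Lemma partial_sum_preimage (X : nat -> T -> nat) c k b :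
  partial_sum X c.+1 @^-1` b `&` partial_sum X c @^-1` [set k] =
  partial_sum X c @^-1` [set k] `&` X c @^-1` [set x | b (k + x)%N].
Proof.
apply/seteqP; split=> w /=; rewrite /partial_sum big_ord_recr/=.
  by move=> [+ /= e]; rewrite e.
by move=> [e]; rewrite e.
Qed.

Lemma prob_sum_recr (X : nat -> T -> nat) c b :
  (forall j, measurable_fun setT (X j)) -> independent_increments X ->
  P (partial_sum X c.+1 @^-1` b) =
  \sum_(k <oo)
    P (partial_sum X c @^-1` [set k]) * P (X c @^-1` [set x | b (k + x)%N]).
Proof.
move=> mX iX; have mS k := measurable_partial_sum X k mX.
rewrite (prob_partition (partial_sum X c))//; last exact: measurable_nat_preimage.
by apply: eq_eseriesr => k _; rewrite partial_sum_preimage iX.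
Qed.

End discrete.

(** * Product rules for an event against a family of independent coordinates *)

Section independence.
Context {d} {T : measurableType d} {R : realType} (P : probability T R).
Context {I : eqType} (F : I -> set (set T)).
Hypothesis mF : forall i E, F i E -> measurable E.
Local Open Scope ereal_scope.

(* Z and the F i with i outside D are jointly independent. *)
Definition free_of (D : set I) (Z : set T) := forall (J : seq I) (B : I -> set T),
  uniq J -> (forall i, i \in J -> ~ D i) -> (forall i, F i (B i)) ->
  P (Z `&` \big[setI/setT]_(i <- J) B i) = P Z * \prod_(i <- J) P (B i).

Lemma free_of_sub (D D' : set I) (Z : set T) :
  D `<=` D' -> free_of D Z -> free_of D' Z.
Proof.
by move=> sD fZ J B uJ JD FB; apply: fZ => // i iJ Di; apply: (JD i iJ); exact: sD.
Qed.

Lemma free_of_set0 (D : set I) : free_of D set0.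
Proof. by move=> J B _ _ _; rewrite set0I measure0 mul0e. Qed.

(** Moving E from the family into Z uses up the index i. Non-emptiness of the classes provides the
    total selection [B] over which [free_of] quantifies, even when the list of indices is empty. *)
Lemma free_of_step (D : set I) (Z E : set T) (i : I) :
  free_of D Z -> ~ D i -> F i E -> (forall j, F j !=set0) ->
  P (Z `&` E) = P Z * P E /\ free_of (D `|` [set i]) (Z `&` E).
Proof.
move=> fZ Di FE FN0.
have key J B : uniq J -> (forall j, j \in J -> ~ (D `|` [set i]) j) ->
    (forall j, F j (B j)) ->
    P (Z `&` E `&` \big[setI/setT]_(j <- J) B j) =
    P Z * P E * \prod_(j <- J) P (B j).
  move=> uJ JD FB.
  (* E is put at index i of an otherwise unchanged selection, and the rule for Z is read for the
     list [i :: J]. *)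
  pose B' j := if j == i then E else B j.
  have iJ : i \notin J by apply/negP => /JD; apply; right.
  have eqB j : j \in J -> B' j = B j.
    by move=> jJ; rewrite /B'; case: eqP => // ji; rewrite -ji jJ in iJ.
  have eqI : \big[setI/setT]_(j <- J) B' j = \big[setI/setT]_(j <- J) B j.
    exact: eq_big_seq.
  have eqPr : \prod_(j <- J) P (B' j) = \prod_(j <- J) P (B j).
    by apply: eq_big_seq => j jJ; rewrite eqB.
  have := fZ (i :: J) B'; rewrite !big_cons eqI eqPr /B' eqxx setIA muleA.
  apply => /=; first by rewrite iJ.
    by move=> j; rewrite inE => /orP[/eqP ->//|/JD jD Dj]; apply: jD; left.
  by move=> j; case: eqVneq => [->|].
have PZE : P (Z `&` E) = P Z * P E.
  have [B FB] : exists B : I -> set T, forall j, F j (B j).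
    have /choice[B HB] : forall j, exists b, F j b by move=> j; exact: FN0.
    by exists B.
  by have := key [::] B; rewrite !big_nil setIT mule1; apply.
by split => // J B uJ JD FB; rewrite PZE; exact: key.
Qed.

(** Both sides of the product rule are countably additive in Z, so it may be checked on slices,
    where random indices become constants. *)
Lemma free_of_partition (D : set I) (Z : set T) (f : T -> nat) :
  measurable Z -> measurable_fun setT f ->
  (forall k, free_of D (Z `&` f @^-1` [set k])) -> free_of D Z.
Proof.
move=> mZ mf fZ J B uJ JD FB.
have mB : measurable (\big[setI/setT]_(i <- J) B i).
  by apply: bigsetI_measurable => i _; exact: (mF i).
have mk k : measurable (Z `&` f @^-1` [set k]).
  by apply: measurableI => //; exact: measurable_nat_preimage.
rewrite (prob_partition P f)//; last exact: measurableI.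
rewrite [in RHS](prob_partition P f)//.
under eq_eseriesr do rewrite setIAC fZ//.
have p_ge0 : 0 <= \prod_(i <- J) P (B i) by rewrite prode_ge0.
have /fineK <- : \prod_(i <- J) P (B i) \is a fin_num.
  apply: (big_ind (fun x => x \is a fin_num)) => //; first by move=> x y; exact: fin_numM.
  by move=> i _; apply: fin_num_measure; exact: (mF i).
rewrite muleC -nneseriesZl//.
by under eq_eseriesr do rewrite muleC.
Qed.

Section sums.
Variables (r : nat -> I) (X : nat -> T -> nat).
Hypotheses (r_inj : injective r) (mX : forall j, measurable_fun setT (X j)).
Hypothesis FX : forall j b, F (r j) (X j @^-1` b).
Hypothesis FN0 : forall j, F j !=set0.

Let S := partial_sum X.

Let mS c : measurable_fun setT (S c).
Proof. exact: measurable_partial_sum. Qed.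

Let mSb c b : measurable (S c @^-1` b).
Proof. exact: measurable_nat_preimage. Qed.

Let sum_recr c b Z k :
  Z `&` S c.+1 @^-1` b `&` S c @^-1` [set k] =
  Z `&` S c @^-1` [set k] `&` X c @^-1` [set x | b (k + x)%N].
Proof. by rewrite -setIA partial_sum_preimage setIA. Qed.

Let fresh (D : set I) c : (forall j, ~ D (r j)) ->
  ~ (D `|` r @` [set j | (j < c)%N]) (r c).
Proof. by move=> Dr [/Dr//|[j /= jc /r_inj jE]]; rewrite jE ltnn in jc. Qed.

Let sum0 b : S 0%N @^-1` b = setT \/ S 0%N @^-1` b = set0.
Proof.
have [b0|b0] := pselect (b 0%N); [left|right]; apply/seteqP; split => w;
  by rewrite /= /S /partial_sum big_ord0.
Qed.

(** On the slice where the first c terms sum to k, an event of the next partial sum is an event of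
    the single fresh coordinate [r c]. So [free_of_step] treats each slice and [free_of_partition]
    recombines them. *)
Lemma free_of_partial_sum D Z c b :
  measurable Z -> (forall j, ~ D (r j)) -> free_of D Z ->
  free_of (D `|` r @` [set j | (j < c)%N]) (Z `&` S c @^-1` b).
Proof.
move=> mZ Dr fZ; elim: c b => [|c IH] b.
  case: (sum0 b) => ->; last by rewrite setI0; exact: free_of_set0.
  by rewrite setIT; apply: free_of_sub fZ; left.
apply: (free_of_partition _ _ (S c)) => //; first exact: measurableI.
move=> k; rewrite sum_recr.
apply: free_of_sub
  (free_of_step _ _ _ (r c) (IH [set k]) (fresh _ c Dr) (FX _ _) FN0).2.
move=> i [[Di|[j /= jc <-]]|->]; [by left|right..].
  by exists j => //=; rewrite ltnS ltnW.
by exists c => /=.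
Qed.

Lemma prob_partial_sum_step D Z c k b :
  measurable Z -> (forall j, ~ D (r j)) -> free_of D Z ->
  P (Z `&` S c @^-1` [set k] `&` X c @^-1` b) =
  P (Z `&` S c @^-1` [set k]) * P (X c @^-1` b).
Proof.
move=> mZ Dr fZ.
exact: (free_of_step _ _ _ _ (free_of_partial_sum _ _ c [set k] mZ Dr fZ)
  (fresh _ c Dr) (FX _ _) FN0).1.
Qed.

Hypothesis fT : free_of set0 setT.

Lemma free_independent_increments : independent_increments P X.
Proof.
move=> c k b; rewrite -[_ @^-1` [set k]]setTI.
exact: (prob_partial_sum_step set0 setT c k _ measurableT (fun _ => id) fT).
Qed.

(** All of [range r] is declared used, not just the first c indices: c will be random, and the set
    of used indices must be the same on every slice. *)
Lemma free_of_sum D Z c b :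
  measurable Z -> (forall j, ~ D (r j)) -> free_of D Z ->
  P (Z `&` S c @^-1` b) = P Z * P (S c @^-1` b) /\
  free_of (D `|` range r) (Z `&` S c @^-1` b).
Proof.
move=> mZ Dr fZ; split; last first.
  apply: free_of_sub (free_of_partial_sum D Z c b mZ Dr fZ) => i.
  by move=> [Di|[j _ <-]]; [left|right; exists j].
elim: c b => [|c IH] b.
  case: (sum0 b) => ->; first by rewrite setIT probability_setT mule1.
  by rewrite setI0 measure0 mule0.
rewrite (prob_partition P (S c))//; last exact: measurableI.
rewrite prob_sum_recr//; last exact: free_independent_increments.
rewrite -nneseriesZ_prob//; last by move=> k; rewrite mule_ge0.
apply: eq_eseriesr => k _.
by rewrite sum_recr (prob_partial_sum_step D)// IH muleA.
Qed.

Variables (e : I) (u : T -> nat) (cu : nat -> nat).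
Hypotheses (re : ~ range r e) (mu : measurable_fun setT u).
Hypothesis Fu : forall k, F e (u @^-1` [set k]).

(** One abstract generation: u is the discrete information read from the fresh coordinate e, and
    [cu] the number of summands it dictates. On {u = k} this number is constant, so u is split off
    first and the sum after it. The resulting series contains only laws of u and of sums of fixed
    length, and these can be compared across probability spaces. *)
Lemma free_of_gen D Z (W : nat -> set nat) :
  measurable Z -> (forall j, ~ D (r j)) -> ~ D e -> free_of D Z ->
  P (Z `&` [set w | W (u w) (S (cu (u w)) w)]) =
    P Z * \sum_(k <oo) (P (u @^-1` [set k]) * P (S (cu k) @^-1` W k)) /\
  free_of (D `|` [set e] `|` range r) (Z `&` [set w | W (u w) (S (cu (u w)) w)]).
Proof.
move=> mZ Dr De fZ; set E := [set w | _].
have EE k : E `&` u @^-1` [set k] = u @^-1` [set k] `&` S (cu k) @^-1` W k.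
  by apply/seteqP; split=> w; rewrite /E /= => -[]; [move=> + uk|move=> uk];
    rewrite uk.
have mk k : measurable (u @^-1` [set k]) by exact: measurable_nat_preimage.
have mE : measurable E.
  rewrite (bigcup_preimage_nat u E); apply: bigcup_measurable => k _.
  by rewrite EE; exact: measurableI.
have st k := free_of_step _ _ _ _ fZ De (Fu k) FN0.
have H k : P (Z `&` E `&` u @^-1` [set k]) =
    P Z * (P (u @^-1` [set k]) * P (S (cu k) @^-1` W k)) /\
    free_of (D `|` [set e] `|` range r) (Z `&` E `&` u @^-1` [set k]).
  rewrite -setIA EE setIA.
  have Der j : ~ (D `|` [set e]) (r j).
    by move=> [/Dr//|/= rje]; apply: re; exists j.
  have [-> ?] := free_of_sum _ _ (cu k) (W k)
    (measurableI _ _ mZ (mk k)) Der (st k).2.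
  by rewrite (st k).1 muleA.
split.
  rewrite (prob_partition P u)//; last exact: measurableI.
  rewrite -nneseriesZ_prob//; last by move=> k; rewrite mule_ge0.
apply: eq_eseriesr => k _; exact: (H k).1.
apply: (free_of_partition _ _ u) => //; first exact: measurableI.
by move=> k; exact: (H k).2.
Qed.
End sums.
End independence.

(** * Two independent families *)

Lemma partial_sum_same_law {d d'} {T : measurableType d} {T' : measurableType d'}
    {R : realType} (P : probability T R) (Q : probability T' R)
    (X : nat -> T -> nat) (Y : nat -> T' -> nat) :
  (forall j, measurable_fun setT (X j)) ->
  (forall j, measurable_fun setT (Y j)) ->
  independent_increments P X -> independent_increments Q Y ->
  (forall j b, P (X j @^-1` b) = Q (Y j @^-1` b)) ->
  forall c b, P (partial_sum X c @^-1` b) = Q (partial_sum Y c @^-1` b).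
Proof.
move=> mX mY iX iY XY; elim=> [|c IH] b; last first.
  rewrite !prob_sum_recr//; apply: eq_eseriesr => k _.
  by rewrite IH XY.
have [b0|b0] := pselect (b 0%N).
  rewrite (_ : _ @^-1` b = setT); last first.
    by apply/seteqP; split=> w //= _; rewrite /partial_sum big_ord0.
  rewrite (_ : _ @^-1` b = setT) ?probability_setT//.
  by apply/seteqP; split=> w //= _; rewrite /partial_sum big_ord0.
rewrite (_ : _ @^-1` b = set0); last first.
  by apply/seteqP; split=> w //=; rewrite /partial_sum big_ord0.
rewrite (_ : _ @^-1` b = set0) ?measure0//.
by apply/seteqP; split=> w //=; rewrite /partial_sum big_ord0.
Qed.

Lemma bigsetI_seq {I : eqType} {T : Type} (J : seq I) (B : I -> set T) :
  \big[setI/setT]_(i <- J) B i = \bigcap_(i in [set` J]) B i.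
Proof.
elim: J => [|i J IH]; first by rewrite big_nil; apply/seteqP; split.
rewrite big_cons IH; apply/seteqP; split=> w.
  by move=> [Bi BJ] j /=; rewrite inE => /orP[/eqP ->//|]; exact: BJ.
by move=> BJ; split=> [|j /= jJ]; apply: BJ; rewrite /= inE ?eqxx ?jJ ?orbT.
Qed.

Section family.
Context {d dM} {T : measurableType d} {R : realType} {P : probability T R}
  {M : measurableType dM} {I1 I2 : eqType}
  (X : I1 -> {RV P >-> M}) (Y : I2 -> {RV P >-> nat}).
Local Open Scope ereal_scope.

(** Marks and offspring share one index type, so that [free_of] can speak of both at once. The
    offspring classes admit every set of naturals because all of them are measurable. *)
Definition sum_family (i : I1 + I2) : set (set T) :=
  match i with
  | inl i => [set A | exists2 E, measurable E & A = X i @^-1` E]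
  | inr j => [set A | exists b, A = Y j @^-1` b]
  end.

Lemma sum_family_measurable i A : sum_family i A -> measurable A.
Proof.
case: i => i /= [E].
  by move=> mE ->; rewrite -[X in measurable X]setTI; exact: measurable_funP.
by move=> ->; exact: measurable_nat_preimage.
Qed.

Lemma sum_family_neq0 i : sum_family i !=set0.
Proof.
by case: i => i /=; [exists (X i @^-1` setT); exists setT|
  exists (Y i @^-1` setT); exists setT].
Qed.

Lemma sigma_of_bigI {I : eqType} {d'} {U : measurableType d'}
    (V : I -> {RV P >-> U}) (J : seq I) (B : I -> set U) :
  (forall i, measurable (B i)) ->
  sigma_of V (\big[setI/setT]_(i <- J) (V i @^-1` B i)).
Proof.
move=> mB; pose G := \bigcup_i preimage_set_system setT (V i) measurable.
apply: (@bigsetI_measurable _ (g_sigma_algebraType G)) => i _.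
apply: sub_sigma_algebra; exists i => //; exists (B i) => //.
by rewrite setTI.
Qed.

Lemma perm_sum (J : seq (I1 + I2)) : exists J1 J2,
  perm_eq J (map inl J1 ++ map inr J2).
Proof.
elim: J => [|[i|j] J [J1 [J2 J12]]]; first by exists [::], [::].
  by exists (i :: J1), J2; rewrite /= perm_cons.
exists J1, (j :: J2); rewrite /= perm_sym.
by rewrite -cat1s perm_catCA /= perm_cons perm_sym.
Qed.

(** Independence within each family and between the generated sigma-algebras combine into joint
    independence, after the indices are sorted into marks and offspring. Z is the third source: an
    event of X_0 for the process, the whole space for the generic generation. *)
Lemma free_of_family Z :
  mutually_independent X -> mutually_independent Y ->
  (forall A B, sigma_of X A -> sigma_of Y B ->
    P (A `&` B `&` Z) = P A * P B * P Z) ->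
  free_of P sum_family set0 Z.
Proof.
move=> iX iY XYZ J B uJ _ FB.
have /choice[E1 HE1] : forall i, exists E, measurable E /\ B (inl i) = X i @^-1` E.
  by move=> i; have [E mE BE] := FB (inl i); exists E.
have /choice[E2 HE2] : forall j, exists b, B (inr j) = Y j @^-1` b.
  by move=> j; exact: FB (inr j).
have [J1 [J2 J12]] := perm_sum J.
move: uJ; rewrite (perm_uniq J12) cat_uniq => /and3P[uJ1 _ uJ2].
have {}uJ1 : uniq J1 by apply: map_uniq uJ1.
have {}uJ2 : uniq J2 by apply: map_uniq uJ2.
rewrite !(perm_big _ J12)/= !big_cat/= !big_map.
under eq_bigr do rewrite (HE1 _).2.
under [X in _ `&` (_ `&` X)]eq_bigr do rewrite HE2.
rewrite setIC XYZ; last 2 first.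
- by apply: sigma_of_bigI => i; exact: (HE1 i).1.
- exact: sigma_of_bigI.
rewrite muleC; congr (_ * _); congr (_ * _).
  rewrite bigsetI_seq iX//; last by move=> i; exact: (HE1 i).1.
  by apply: eq_bigr => i _; rewrite (HE1 i).2.
by rewrite bigsetI_seq iY//; apply: eq_bigr => i _; rewrite HE2.
Qed.

End family.

(** * The law of one generation *)

Section mark_code.
Context {dM} {M : measurableType dM} (mm : mark_maps M).

Lemma measurable_control k : measurable_fun setT (fun e => control mm e k).
Proof.
apply: (measurable_nat_comp2 _ _ addn); last exact: measurable_mB.
apply: (measurable_nat_comp2 _ _ muln); first exact: measurable_mA.
exact: measurable_mC.
Qed.

(* Packing (A, N(k)) into one number lets us partition by a single nat-valued
   variable. *)
Definition mark_code (k : nat) (e : M) : nat := pickle (mA mm e, control mm e k).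

(** Numbers that are not codes receive the default (0, 0); their preimages under [mark_code] are
    empty, so they contribute zero to the series. *)
Definition decode (u : nat) : nat * nat := odflt (0%N, 0%N) (unpickle u).

Lemma decode_mark_code k e : decode (mark_code k e) = (mA mm e, control mm e k).
Proof. by rewrite /decode /mark_code pickleK. Qed.

Lemma measurable_mark_code k : measurable_fun setT (mark_code k).
Proof.
apply: (measurable_nat_comp2 _ _ (fun a c => pickle (a, c))).
  exact: measurable_mA.
exact: measurable_control.
Qed.

End mark_code.

Section model.
Context {dT dQ dM : measure_display} {R : realType}
  {T : measurableType dT} {T' : measurableType dQ} {M : measurableType dM}
  {P : probability T R} {Q : probability T' R}
  (mm : mark_maps M) (S : cbp_data P M) (G : generation_data Q M)
  (xi : {RV Q >-> nat}).
Hypothesis hmodel : cbp_model S G xi.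
Local Open Scope ereal_scope.

Let FP := sum_family (mark S) (offspring_array S).
Let FQ := sum_family (fun _ : unit => gmark G) (goffspring G).

(* The coordinates that determine the first n generations. *)
Definition past (n : nat) : set (nat + nat * nat) :=
  [set i | match i with inl j => (j < n)%N | inr jl => (jl.1 < n)%N end].

Let row (n j : nat) : nat + nat * nat := inr (n, j).
Let col (j : nat) : unit + nat := inr j.

Let row_inj n : injective (row n). Proof. by move=> i j []. Qed.
Let col_inj : injective col. Proof. by move=> i j []. Qed.

Let mFP i E : FP i E -> measurable E. Proof. exact: sum_family_measurable. Qed.
Let mFQ i E : FQ i E -> measurable E. Proof. exact: sum_family_measurable. Qed.
Let FP0 i : FP i !=set0. Proof. exact: sum_family_neq0. Qed.
Let FQ0 i : FQ i !=set0. Proof. exact: sum_family_neq0. Qed.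

Let FPoff n j b : FP (row n j) (offspring S n j @^-1` b).
Proof. by exists b. Qed.

Let FQoff j b : FQ (col j) (goffspring G j @^-1` b).
Proof. by exists b. Qed.

Let FPmark n (f : M -> nat) c : measurable_fun setT f ->
  FP (inl n) ((f \o mark S n) @^-1` [set c]).
Proof.
by move=> mf; exists (f @^-1` [set c]) => //; exact: measurable_nat_preimage.
Qed.

Let FQmark (f : M -> nat) c : measurable_fun setT f ->
  FQ (inl tt) ((f \o gmark G) @^-1` [set c]).
Proof.
by move=> mf; exists (f @^-1` [set c]) => //; exact: measurable_nat_preimage.
Qed.

Let moff n j : measurable_fun setT (offspring S n j).
Proof. exact: measurable_funP. Qed.

Let mgoff j : measurable_fun setT (goffspring G j).
Proof. exact: measurable_funP. Qed.

Let mmark n (f : M -> nat) : measurable_fun setT f ->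
  measurable_fun setT (f \o mark S n).
Proof. by move=> mf; apply: measurableT_comp. Qed.

Let mgmark (f : M -> nat) : measurable_fun setT f ->
  measurable_fun setT (f \o gmark G).
Proof. by move=> mf; apply: measurableT_comp. Qed.

Lemma measurable_Xn n : measurable_fun setT (Xn mm S n).
Proof.
elim: n => [|n IH] /=; first exact: measurable_funP.
apply: (measurable_nat_comp (Xn mm S n) (fun k w =>
  partial_sum (offspring S n) (control mm (mark S n w) k) w)) => // k.
apply: (measurable_nat_comp (control mm ^~ k \o mark S n)
  (partial_sum (offspring S n))).
  exact: (mmark n _ (measurable_control mm k)).
by move=> c; exact: measurable_partial_sum.
Qed.

Lemma measurable_Nn n : measurable_fun setT (Nn mm S n).
Proof.
apply: (measurable_nat_comp (Xn mm S n) (fun k w => control mm (mark S n w) k)).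
  exact: measurable_Xn.
by move=> k; exact: (mmark n _ (measurable_control mm k)).
Qed.

Lemma measurable_An n : measurable_fun setT (An mm S n).
Proof. exact: (mmark n _ (measurable_mA mm)). Qed.

Lemma measurable_gN k : measurable_fun setT (gN mm G k).
Proof. exact: (mgmark _ (measurable_control mm k)). Qed.

Lemma measurable_gA : measurable_fun setT (gA mm G).
Proof. exact: (mgmark _ (measurable_mA mm)). Qed.

(** Base of the induction in [free_Xn]; the independence of X_0 from marks and offspring enters
    here. *)
Let free_init k : free_of P FP set0 (Xn mm S 0 @^-1` [set k]).
Proof.
have [[[iO _] [iM _] i3] _] := hmodel.
apply: free_of_family => // A B sA sB; apply: i3 => //.
apply: sub_sigma_algebra; exists tt => //; exists [set k] => //.
by rewrite setTI.
Qed.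

Let freeP : free_of P FP set0 setT.
Proof.
apply: (free_of_partition _ _ mFP _ _ (Xn mm S 0)) => //.
by move=> k; rewrite setTI; exact: free_init.
Qed.

Let freeQ : free_of Q FQ set0 setT.
Proof.
have [_ [[iO _] i2]] := hmodel.
apply: free_of_family => //.
  (* A duplicate-free list over [unit] has at most one entry, so the single generic mark forms an
     independent family. *)
  move=> J B; case: J => [|[] [|[] J]] //= _ mB.
    rewrite big_nil (_ : \bigcap_(i in _) _ = setT) ?probability_setT//.
    by apply/seteqP; split.
  rewrite big_seq1 (_ : \bigcap_(i in _) _ = gmark G @^-1` B tt)//.
  by apply/seteqP; split=> [w /(_ tt)|w Bw [] _]//; apply; rewrite /= inE.
by move=> A B sA sB; rewrite setIT i2// probability_setT mule1.
Qed.

Let iiP n : independent_increments P (offspring S n).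
Proof.
exact: (free_independent_increments P _ mFP _ _ (row_inj n) (moff n) (FPoff n) FP0 freeP).
Qed.

Lemma independent_increments_goffspring :
  independent_increments Q (goffspring G).
Proof.
exact: (free_independent_increments Q _ mFQ _ _ col_inj mgoff FQoff FQ0 freeQ).
Qed.

Lemma goffspring_law j b : Q (goffspring G j @^-1` b) = Q (xi @^-1` b).
Proof. by have [_ [[_ sl] _]] := hmodel; exact: sl. Qed.

Let offspring_law n c b : P (partial_sum (offspring S n) c @^-1` b) =
  Q (partial_sum (goffspring G) c @^-1` b).
Proof.
apply: partial_sum_same_law => //.
  exact: independent_increments_goffspring.
move=> j {}b; rewrite goffspring_law.
by have [[[_ sl] _ _] _] := hmodel; exact: (sl (n, j)).
Qed.

Let mark_law n (f : M -> nat) c : measurable_fun setT f ->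
  P ((f \o mark S n) @^-1` [set c]) = Q ((f \o gmark G) @^-1` [set c]).
Proof.
move=> mf; have [[_ [_ sl] _] _] := hmodel.
by apply: (sl n (f @^-1` [set c])); exact: measurable_nat_preimage.
Qed.

(** After the transfer of laws, the series depends on neither n nor the process: the history
    survives only in the factor P Z. *)
Let genP n k Z (W : nat -> set nat) :
  measurable Z -> free_of P FP (past n) Z ->
  let E := [set w | W (mark_code mm k (mark S n w)) (partial_sum (offspring S n)
                      (control mm (mark S n w) k) w)] in
  P (Z `&` E) = P Z * \sum_(c <oo)
    (Q ((mark_code mm k \o gmark G) @^-1` [set c]) *
     Q (partial_sum (goffspring G) (decode c).2 @^-1` W c)) /\
  free_of P FP (past n.+1) (Z `&` E).
Proof.
move=> mZ fZ E.
have Dr j : ~ past n (row n j) by rewrite /past /= ltnn.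
have De : ~ past n (inl n) by rewrite /past /= ltnn.
have re : ~ range (row n) (inl n) by move=> [].
have -> : E = [set w | W ((mark_code mm k \o mark S n) w)
    (partial_sum (offspring S n) (decode ((mark_code mm k \o mark S n) w)).2 w)].
  by apply/funext => w; rewrite /= decode_mark_code.
have [-> fZE] := free_of_gen P _ mFP _ _ (row_inj n) (moff n) (FPoff n) FP0 freeP _ _
  (fun u => (decode u).2) re (mmark n _ (measurable_mark_code mm k))
  (fun c => FPmark n _ c (measurable_mark_code mm k)) _ _ W mZ Dr De fZ.
split.
  congr (_ * _); apply: eq_eseriesr => c _.
  by rewrite mark_law ?offspring_law//; exact: measurable_mark_code.
apply: free_of_sub fZE => -[i|[i j]]; rewrite /past /=.
  by move=> [[in_|[->]]|[? _ []]]//; exact: ltnW.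
by move=> [[in_|//]|[? _ [<- _]]]//; exact: ltnW.
Qed.

(** This is the series of [genP], computed on the generic space with Z the whole space. Both sides
    are thus evaluated separately and matched term by term. *)
Let genQ k (W : nat -> set nat) :
  Q [set w | W (mark_code mm k (gmark G w)) (partial_sum (goffspring G)
               (control mm (gmark G w) k) w)] =
  \sum_(c <oo) (Q ((mark_code mm k \o gmark G) @^-1` [set c]) *
     Q (partial_sum (goffspring G) (decode c).2 @^-1` W c)).
Proof.
have re : ~ range col (inl tt) by move=> [].
have [+ _] := free_of_gen Q _ mFQ _ _ col_inj mgoff FQoff FQ0 freeQ _ _
  (fun u => (decode u).2) re (mgmark _ (measurable_mark_code mm k))
  (fun c => FQmark _ c (measurable_mark_code mm k)) _ _ W measurableT
  (fun _ => id) id freeQ.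
rewrite setTI probability_setT mul1e => <-; congr (Q _).
by apply/funext => w; rewrite /= decode_mark_code.
Qed.

(** Slicing by X_n = l freezes the argument of the control, and X_(n+1) becomes a sum driven by the
    n-th mark and row alone; [genP] then advances the past by one generation. *)
Let free_Xn n k : free_of P FP (past n) (Xn mm S n @^-1` [set k]).
Proof.
elim: n k => [|n IH] k; first by apply: free_of_sub (free_init k).
have mk n' k' : measurable (Xn mm S n' @^-1` [set k']).
  by apply: measurable_nat_preimage; exact: measurable_Xn.
apply: (free_of_partition _ _ mFP _ _ (Xn mm S n)) => //; first exact: measurable_Xn.
move=> l; have [_] := genP n l _ (fun=> [set k]) (mk n l) (IH l).
congr free_of; apply/seteqP; split=> w /=.
  by move=> [Xl]; rewrite Xl.
by move=> [+ Xl]; rewrite Xl.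
Qed.

(** The Markov property at time n, with the conditioning multiplied out and the joint law of
    multiplier, control and next size transferred to the generic space. *)
Lemma prob_generation n k (W : nat -> nat -> set nat) :
  P ([set w | W (An mm S n w) (Nn mm S n w) (Xn mm S n.+1 w)] `&`
     Xn mm S n @^-1` [set k]) =
  P (Xn mm S n @^-1` [set k]) *
  Q [set w | W (gA mm G w) (gN mm G k w)
               (partial_sum (goffspring G) (gN mm G k w) w)].
Proof.
pose W' c := W (decode c).1 (decode c).2.
have := genQ k W'; rewrite /W'.
under eq_set do rewrite decode_mark_code/=.
move=> ->.
have mk : measurable (Xn mm S n @^-1` [set k]).
  by apply: measurable_nat_preimage; exact: measurable_Xn.
have [<- _] := genP n k _ W' mk (free_Xn n k).
congr (P _); apply/seteqP; split=> w /=; rewrite /W' decode_mark_code /Nn /=.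
  by move=> [+ Xk]; rewrite Xk.
by move=> [Xk]; rewrite Xk.
Qed.

(** N_n is built from the past and the n-th mark only, so the n-th row is still fresh given N_n.
    This serves the bound that is geometric in N_n. *)
Lemma prob_Nn_sum n c b :
  P (Nn mm S n @^-1` [set c] `&` partial_sum (offspring S n) c @^-1` b) =
  P (Nn mm S n @^-1` [set c]) * Q (partial_sum (goffspring G) c @^-1` b).
Proof.
rewrite -(offspring_law n).
have mN : measurable (Nn mm S n @^-1` [set c]).
  by apply: measurable_nat_preimage; exact: measurable_Nn.
have Dr j : ~ (past n `|` [set inl n]) (row n j).
  by rewrite /past /= ltnn => -[].
apply: (free_of_sum P _ mFP _ _ (row_inj n) (moff n) (FPoff n) FP0 freeP _ _ c b mN Dr _).1.
apply: (free_of_partition _ _ mFP _ _ (Xn mm S n)) => //; first exact: measurable_Xn.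
move=> k; have De : ~ past n (inl n) by rewrite /past /= ltnn.
have [_] := free_of_step P _ _ _ _ _ (free_Xn n k) De
  (FPmark n _ c (measurable_control mm k)) FP0.
by congr free_of; apply/seteqP; split=> w /= [? ?]; subst.
Qed.

Lemma prob_gN_sum k c b :
  Q (gN mm G k @^-1` [set c] `&` partial_sum (goffspring G) c @^-1` b) =
  Q (gN mm G k @^-1` [set c]) * Q (partial_sum (goffspring G) c @^-1` b).
Proof.
have mN : measurable (gN mm G k @^-1` [set c]).
  by apply: measurable_nat_preimage; exact: measurable_gN.
have Dr j : ~ (set0 `|` [set inl tt]) (col j) by case.
apply: (free_of_sum Q _ mFQ _ _ col_inj mgoff FQoff FQ0 freeQ _ _ c b mN Dr _).1.
have [_] := free_of_step Q _ _ _ _ (inl tt) freeQ (id : ~ set0 _)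
  (FQmark _ c (measurable_control mm k)) FQ0.
by rewrite setTI.
Qed.

End model.

(** * Moments of sums of i.i.d. variables *)

Section power_inequalities.
Context {R : realType}.
Implicit Types p r s t u v x y : R.

Lemma powRB_gt0 x r s : 0 < x -> x `^ (r - s) = x `^ r / x `^ s.
Proof. by move=> x0; rewrite powRB// (gt_eqF x0) implybT. Qed.

(** Young's inequality for the product s * 1 with conjugate exponents r and r / (r - 1). The case r
    = 1, where the conjugate exponent degenerates, is separate. *)
Lemma powR_bernoulli s r : 0 <= s -> 1 <= r -> 1 + r * (s - 1) <= s `^ r.
Proof.
move=> s0; rewrite le_eqVlt => /predU1P[<-|r1].
  by rewrite powRr1// mul1r addrC subrK.
have r0 : 0 < r by lra.
have q0 : 0 < r / (r - 1) by rewrite divr_gt0//; lra.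
have := conjugate_powR s0 (@ler01 R) r0 q0.
rewrite powR1 mulr1 => /(_ _) H.
have {}H : s <= s `^ r / r + 1 / (r / (r - 1)) by apply: H; field; lra.
have : r * s <= r * (s `^ r / r + 1 / (r / (r - 1))) by rewrite ler_pM2l.
rewrite (_ : r * (_ + _) = s `^ r + (r - 1)); last by field; lra.
lra.
Qed.

(** Bernoulli's inequality at 1/v, multiplied by v^r: the tangent at v lies below the curve at the
    point 1. *)
Lemma powR_above_tangent v r : 0 < v -> 1 <= r ->
  v `^ r <= 1 + r * (v - 1) * v `^ (r - 1).
Proof.
move=> v0 r1; have vi : 0 <= v^-1 by rewrite invr_ge0 ltW.
have := powR_bernoulli _ _ vi r1.
have vr : 0 < v `^ r by exact: powR_gt0.
rewrite -(ler_pM2l vr) -powRM//; last exact: ltW.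
rewrite divff ?gt_eqF// powR1.
have -> : v `^ (r - 1) = v `^ r / v.
  by rewrite powRB_gt0// powRr1 ?(ltW v0).
rewrite (_ : v `^ r * (1 + _) = v `^ r - r * (v - 1) * (v `^ r / v)); first lra.
by field; rewrite gt_eqF.
Qed.

(** The first summand is the second-order coefficient for |t| < 1. For |t| >= 1, the second comes
    from |1 + t|^p <= (2|t|)^p and the third absorbs the linear term. *)
Definition taylor_cst p := p * p * 2 `^ p + 2 `^ p + p.

Lemma taylor_cst_ge1 p : 2 <= p -> 1 <= taylor_cst p.
Proof.
move=> p2; rewrite /taylor_cst.
have : 0 <= 2 `^ p :> R by exact: powR_ge0.
have : 0 <= p * p * 2 `^ p by rewrite !mulr_ge0 ?powR_ge0//; lra.
lra.
Qed.

Lemma powR_taylor1 p t : 2 <= p ->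
  `|1 + t| `^ p <= 1 + p * t + taylor_cst p * (t ^+ 2 + `|t| `^ p).
Proof.
move=> p2; have p0 : 0 <= p by lra.
have two_ge0 : 0 <= 2 `^ p :> R by exact: powR_ge0.
have pp2_ge0 : 0 <= p * p * 2 `^ p by rewrite !mulr_ge0.
have tp_ge0 : 0 <= `|t| `^ p by exact: powR_ge0.
have t2_ge0 : 0 <= t ^+ 2 by exact: sqr_ge0.
have [t1|t1] := ltP `|t| 1; last first.
  have tp1 : `|t| <= `|t| `^ p by apply: le1r_powR => //; lra.
  have le1 : `|1 + t| `^ p <= 2 `^ p * `|t| `^ p.
    rewrite -powRM//; apply: ge0_ler_powR; rewrite ?nnegrE ?mulr_ge0//.
    by apply: le_trans (ler_normD _ _) _; rewrite normr1; lra.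
  have pt : - (p * `|t| `^ p) <= p * t.
    rewrite -mulrN ler_wpM2l//.
    by have := ler_norm (- t); rewrite normrN; lra.
  have : 0 <= taylor_cst p * t ^+ 2.
    by rewrite mulr_ge0//; have := taylor_cst_ge1 _ p2; lra.
  have : 0 <= p * p * 2 `^ p * `|t| `^ p by rewrite mulr_ge0.
  rewrite /taylor_cst; lra.
move: t1; rewrite ltr_norml => /andP[t1 t1'].
have v0 : 0 < 1 + t by lra.
rewrite ger0_norm ?(ltW v0)//.
have p1 : 1 <= p by lra.
have p1' : 1 <= p - 1 by lra.
have := powR_above_tangent _ _ v0 p1.
rewrite (_ : 1 + t - 1 = t); last lra.
move=> /le_trans; apply.
(* The tangent bound leaves p t ((1 + t)^(p-1) - 1), and the increment of the power p - 1 >= 1 is of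
   order t. The sign of t decides whether that increment is needed from above (tangent at 1 + t) or
   from below (Bernoulli). *)
have key : t * ((1 + t) `^ (p - 1) - 1) <= p * 2 `^ p * t ^+ 2.
  have [t0|t0] := leP 0 t.
    have := powR_above_tangent _ _ v0 p1'.
    rewrite (_ : 1 + t - 1 = t); last lra.
    have w : (1 + t) `^ (p - 1 - 1) <= 2 `^ p.
      apply: (@le_trans _ _ (2 `^ (p - 1 - 1))).
        by apply: ge0_ler_powR; rewrite ?nnegrE; lra.
      by apply: ler_powR; lra.
    have w2 : (p - 1) * t * (1 + t) `^ (p - 1 - 1) <= p * 2 `^ p * t.
      rewrite mulrAC ler_wpM2r// ler_pM ?powR_ge0//; lra.
    move=> H; rewrite expr2 mulrA [leRHS]mulrC ler_wpM2l//; lra.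
  have := powR_bernoulli _ _ (ltW v0) p1'.
  rewrite (_ : 1 + t - 1 = t); last lra.
  move=> H; have : t * ((1 + t) `^ (p - 1) - 1) <= t * ((p - 1) * t).
    by rewrite ler_wnM2l// ?(ltW t0)// lerBrDr addrC.
  move/le_trans; apply.
  rewrite mulrCA -expr2 ler_wpM2r//.
  have : 1 <= 2 `^ p :> R.
    by rewrite -[leLHS](powRr0 2); apply: ler_powR; lra.
  move=> two1; have : p * 1 <= p * 2 `^ p by rewrite ler_wpM2l.
  lra.
have : p * (t * ((1 + t) `^ (p - 1) - 1)) <= p * (p * 2 `^ p * t ^+ 2).
  by rewrite ler_wpM2l.
have : 0 <= (2 `^ p + p) * t ^+ 2 by rewrite mulr_ge0 ?addr_ge0.
have : 0 <= taylor_cst p * `|t| `^ p.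
  by rewrite mulr_ge0//; have := taylor_cst_ge1 _ p2; lra.
rewrite /taylor_cst; lra.
Qed.

(* The slope is p |x|^(p-1) sgn x; only its independence of y matters. *)
Lemma powR_taylor p x : 2 <= p -> exists sl : R, forall y,
  `|x + y| `^ p <=
  `|x| `^ p + sl * y + taylor_cst p * (`|x| `^ (p - 2) * y ^+ 2 + `|y| `^ p).
Proof.
move=> p2; have [->|x0] := eqVneq x 0.
  exists 0 => y; rewrite add0r mul0r addr0 normr0 powR0; last by apply/eqP; lra.
  rewrite add0r mulrDr -[leLHS]add0r lerD//.
    apply: mulr_ge0; first by have := taylor_cst_ge1 _ p2; lra.
    by rewrite mulr_ge0 ?powR_ge0 ?sqr_ge0.
  by rewrite ler_peMl ?powR_ge0// taylor_cst_ge1.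
exists (`|x| `^ p * p / x) => y.
have nx0 : 0 < `|x| by rewrite normr_gt0.
have := powR_taylor1 _ (y / x) p2.
have xp : 0 < `|x| `^ p by exact: powR_gt0.
rewrite -(ler_pM2l xp) -powRM// -normrM (_ : x * _ = x + y); last by field.
move=> /le_trans; apply; rewrite le_eqVlt; apply/orP; left; apply/eqP.
have -> : `|x| `^ (p - 2) = `|x| `^ p / x ^+ 2.
  rewrite powRB_gt0//; congr (_ / _).
  by rewrite powR_mulrn// real_normK ?num_real.
have -> : `|y| `^ p = `|x| `^ p * `|y / x| `^ p.
  by rewrite -powRM// -normrM; congr (`|_| `^ _); field.
field.
exact: x0.
Qed.

(** Split at x^2 = t. The free parameter makes the coefficient of x^p as small as desired, at the
    price of the constant t^(p/2-1). *)
Lemma powR_sub2_split p x t : 2 <= p -> 0 <= x -> 0 < t ->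
  x `^ (p - 2) <= x `^ p / t + t `^ (p / 2 - 1).
Proof.
move=> p2 x0 t0; have [xt|xt] := leP t (x ^+ 2).
  have {}x0 : 0 < x.
    by rewrite lt_neqAle x0 andbT eq_sym; apply: contraTneq xt => ->;
      rewrite expr0n/= -ltNge.
  rewrite -[leLHS]addr0 lerD ?powR_ge0// ler_pdivlMr//.
  rewrite powRB_gt0// powR_mulrn ?(ltW x0)//.
  rewrite mulrAC ler_pdivrMr ?exprn_gt0// ler_wpM2l//.
  exact: powR_ge0.
rewrite -[leLHS]add0r lerD//; first by rewrite divr_ge0 ?powR_ge0// ltW.
rewrite (_ : p - 2 = 2 * (p / 2 - 1)); last by field.
rewrite powRrM powR_mulrn//; apply: ge0_ler_powR; rewrite ?nnegrE ?exprn_ge0 ?(ltW t0) ?(ltW xt)//.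
by lra.
Qed.

Lemma sqr_le_powR p y : 2 <= p -> y ^+ 2 <= 1 + `|y| `^ p.
Proof.
move=> p2; rewrite -real_normK ?num_real//.
have yp : 0 <= `|y| `^ p by exact: powR_ge0.
have [y1|y1] := leP `|y| 1.
  have : `|y| ^+ 2 <= 1 by rewrite expr_le1.
  lra.
have : `|y| ^+ 2 <= `|y| `^ p.
  by rewrite -powR_mulrn//; apply: ler_powR => //; exact: ltW.
lra.
Qed.

(** Bernoulli's inequality at 1 + 1/x, with the factor r lowered to 1. The gain x^(r-1) pays for the
    errors in the induction of [partial_sum_moment_le]. *)
Lemma powR_succ_ge x r : 0 < x -> 1 <= r ->
  x `^ r + x `^ (r - 1) <= (x + 1) `^ r.
Proof.
move=> x0 r1; have s0 : 0 <= 1 + x^-1 by rewrite addr_ge0// invr_ge0 ltW.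
have := powR_bernoulli _ _ s0 r1.
have xr : 0 < x `^ r by exact: powR_gt0.
rewrite -(ler_pM2l xr) -powRM ?(ltW x0)//.
rewrite (_ : x * (1 + x^-1) = x + 1); last by field; rewrite gt_eqF.
move=> /(le_trans _); apply.
rewrite powRB_gt0// powRr1 ?(ltW x0)//.
rewrite mulrDr mulr1 lerD// ler_pM2l//.
rewrite (_ : 1 + x^-1 - 1 = x^-1); last by lra.
by rewrite ler_peMl// invr_ge0 ltW.
Qed.

End power_inequalities.

(** * The moment recursion for centred sums *)

Section moments.
Context {d} {T : measurableType d} {R : realType} (P : probability T R).
Local Open Scope ereal_scope.

Lemma measurable_EFin_nat (f : T -> nat) (h : nat -> R) :
  measurable_fun setT f -> measurable_fun setT (fun w => (h (f w))%:E).
Proof.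
exact: (measurableT_comp (measurable_from_nat (fun k => (h k)%:E))).
Qed.

Lemma integral_nat_le (f : T -> nat) (h1 h2 : nat -> R) :
  measurable_fun setT f -> (forall k, 0 <= h1 k <= h2 k)%R ->
  \int[P]_w (h1 (f w))%:E <= \int[P]_w (h2 (f w))%:E.
Proof.
move=> mf h12; apply: ge0_le_integral => //.
- by move=> w _; rewrite lee_fin; case/andP: (h12 (f w)).
- exact: measurable_EFin_nat.
- exact: measurable_EFin_nat.
- by move=> w _; rewrite lee_fin; case/andP: (h12 (f w)).
Qed.

Lemma integral_nat_affine (f : T -> nat) (h : nat -> R) (a b : R) :
  measurable_fun setT f -> (forall k, 0 <= h k)%R -> (0 <= a)%R -> (0 <= b)%R ->
  \int[P]_w (a * h (f w) + b)%:E = a%:E * \int[P]_w (h (f w))%:E + b%:E.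
Proof.
move=> mf h0 a0 b0; under eq_integral do rewrite EFinD EFinM.
rewrite ge0_integralD//.
- rewrite integral_cst//= probability_setT mule1 ge0_integralZl_EFin//.
  + by move=> w _; rewrite lee_fin.
  + exact: measurable_EFin_nat.
- by move=> w _; rewrite -EFinM lee_fin mulr_ge0.
- exact: (measurable_EFin_nat f (fun k => a * h k)%R).
Qed.

Lemma integrable_nat (f : T -> nat) (h : nat -> R) :
  measurable_fun setT f -> (forall k, 0 <= h k)%R ->
  \int[P]_w (h (f w))%:E < +oo ->
  P.-integrable setT (fun w => (h (f w))%:E).
Proof.
move=> mf h0 hoo; apply/integrableP; split; first exact: measurable_EFin_nat.
by under eq_integral do rewrite gee0_abs ?lee_fin//.
Qed.

Section centered.
Context (xi : T -> nat) (m p M : R).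
Hypotheses (mxi : measurable_fun setT xi) (p2 : (2 <= p)%R).
Hypothesis xi_mean : \int[P]_w ((xi w)%:R)%:E = m%:E.
Hypothesis xi_moment : \int[P]_w (`|(xi w)%:R - m| `^ p)%:E <= M%:E.

(** [powR_taylor] at the fixed point x is integrated: the linear term vanishes by centring, and y^2
    <= 1 + |y|^p lets the p-th moment alone control the rest. *)
Lemma shifted_moment_le x : \int[P]_w (`|x + ((xi w)%:R - m)| `^ p)%:E <=
  (`|x| `^ p + taylor_cst p * (1 + M) * (`|x| `^ (p - 2) + 1))%:E.
Proof.
have [sl Hsl] := powR_taylor p x p2.
pose c := (taylor_cst p * (`|x| `^ (p - 2) + 1))%R.
have C1 : (1 <= taylor_cst p)%R := taylor_cst_ge1 p p2.
have C0 : (0 <= taylor_cst p)%R by exact: le_trans C1.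
have c0 : (0 <= c)%R by apply: mulr_ge0 => //; rewrite addr_ge0 ?powR_ge0.
(* [g1] is the signed linear part, of integral zero; [g2] is the non-negative rest after y^2 has
   been replaced by 1 + |y|^p. *)
pose g1 w := (sl * ((xi w)%:R - m))%R.
pose g2 w := (c * `|(xi w)%:R - m| `^ p + (`|x| `^ p + c))%R.
have ixi : P.-integrable setT (fun w => ((xi w)%:R)%:E).
  by apply: (integrable_nat xi (fun k => k%:R)) => //; rewrite xi_mean ltry.
have icst (r : R) : P.-integrable setT (EFin \o cst r).
  exact: finite_measure_integrable_cst.
have ice : P.-integrable setT (fun w => ((xi w)%:R - m)%:E).
  apply: eq_integrable (integrableB measurableT ixi (icst m)) => //.
have i1 : P.-integrable setT (EFin \o g1).
  exact: eq_integrable (integrableZl measurableT sl ice).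
have i2 : P.-integrable setT (EFin \o g2).
  apply: (integrable_nat xi
      (fun k => c * `|k%:R - m| `^ p + (`|x| `^ p + c))%R) => //.
    by move=> k; rewrite !addr_ge0 ?mulr_ge0 ?powR_ge0.
  rewrite (integral_nat_affine xi (fun k => `|k%:R - m| `^ p)%R)//;
    last by apply: addr_ge0 => //; exact: powR_ge0.
  apply: lte_add_pinfty; last exact: ltry.
  apply: lte_mul_pinfty => //.
  exact: le_lt_trans xi_moment (ltry _).
apply: (@le_trans _ _ (\int[P]_w ((g1 w)%:E + (g2 w)%:E))).
  have pw w : (`|x + ((xi w)%:R - m)| `^ p <= g1 w + g2 w)%R.
    apply: le_trans (Hsl _) _; rewrite /g1 /g2.
    set y := ((xi w)%:R - m)%R.
    have y2 := sqr_le_powR p y p2.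
    have : (taylor_cst p * (`|x| `^ (p - 2) * y ^+ 2) <=
            taylor_cst p * (`|x| `^ (p - 2) * (1 + `|y| `^ p)))%R.
      by apply: ler_wpM2l => //; rewrite ler_wpM2l ?powR_ge0.
    rewrite /c; lra.
  apply: ge0_le_integral => //.
  - exact: (measurable_EFin_nat xi (fun k => `|x + (k%:R - m)| `^ p)%R).
  - exact: (measurable_EFin_nat xi (fun k => sl * (k%:R - m) +
      (c * `|k%:R - m| `^ p + (`|x| `^ p + c)))%R).
  - by move=> w _; rewrite lee_fin.
rewrite (integralD_EFin measurableT i1 i2).
have -> : \int[P]_w (g1 w)%:E = 0.
  rewrite (_ : \int[P]_w (g1 w)%:E = \int[P]_w (sl%:E * ((xi w)%:R - m)%:E))//.
  rewrite integralZl// integralB_EFin//; last exact: icst.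
  by rewrite xi_mean integral_cst//= probability_setT mule1 subee// mule0.
rewrite add0e (integral_nat_affine xi (fun k => `|k%:R - m| `^ p)%R)//;
  last by apply: addr_ge0 => //; exact: powR_ge0.
apply: (@le_trans _ _ (c%:E * M%:E + (`|x| `^ p + c)%:E)).
  by rewrite leeD2r// lee_wpmul2l// lee_fin.
by rewrite -EFinM -EFinD lee_fin /c; lra.
Qed.

End centered.
End moments.

Section sum_moments.
Context {d} {T : measurableType d} {R : realType} (P : probability T R).
Context (xi : T -> nat) (X : nat -> T -> nat) (m p M : R).
Local Open Scope ereal_scope.
Hypotheses (mxi : measurable_fun setT xi) (p2 : (2 <= p)%R).
Hypothesis xi_mean : \int[P]_w ((xi w)%:R)%:E = m%:E.
Hypotheses (M0 : (0 <= M)%R)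
  (xi_moment : \int[P]_w (`|(xi w)%:R - m| `^ p)%:E <= M%:E).
Hypothesis mX : forall j, measurable_fun setT (X j).
Hypothesis iX : independent_increments P X.
Hypothesis lX : forall j b, P (X j @^-1` b) = P (xi @^-1` b).

(** Applied with Z = {S_n = k} and the next summand, and later with Z = {N(k) = c} and the whole sum
    of c terms in the role of [xi]. *)
Lemma integral_freeze (Z : set T) (Y : T -> nat) (h : nat -> \bar R) :
  measurable Z -> measurable_fun setT Y -> (forall k, 0 <= h k) ->
  (forall b, P (Z `&` Y @^-1` b) = P Z * P (xi @^-1` b)) ->
  \int[P]_(w in Z) h (Y w) = P Z * \int[P]_w h (xi w).
Proof.
move=> mZ mY h0 ZY.
have mZY k : measurable (Z `&` Y @^-1` [set k]).
  by apply: measurableI => //; exact: measurable_nat_preimage.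
rewrite [in LHS](bigcup_preimage_nat Y Z) ge0_integral_bigcup//; last 2 first.
- apply: measurable_funTS.
  exact: (measurableT_comp (measurable_from_nat h) mY).
- exact: trivIset_preimage_nat.
rewrite ge0_integral_nat// -nneseriesZ_prob//; last by move=> k; rewrite mule_ge0.
apply: eq_eseriesr => k _.
rewrite (eq_integral (fun=> h k)) ?integral_cst//; last first.
  by move=> w; rewrite inE => -[_ /= ->].
by rewrite -[X in _ * X]/(P (Z `&` Y @^-1` [set k])) ZY muleCA.
Qed.

Let a n := \int[P]_w (`|(partial_sum X n w)%:R - n%:R * m| `^ p)%:E.

Let c := (taylor_cst p * (1 + M))%R.

Let c_gt0 : (0 < c)%R.
Proof.
apply: mulr_gt0; last by rewrite ltr_pwDl.
by apply: lt_le_trans (taylor_cst_ge1 p p2).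
Qed.

(** On {S_n = k} the centred sum is the constant [x k] and the next summand is fresh, so
    [shifted_moment_le] applies slice by slice. [powR_sub2_split] then trades the power p - 2 for
    the power p, which closes the recursion. *)
Lemma partial_sum_moment_step n t : (0 < t)%R ->
  a n.+1 <= (1 + c / t)%:E * a n + (c * (t `^ (p / 2 - 1) + 1))%:E.
Proof.
move=> t0; have mS k := measurable_partial_sum X k mX.
rewrite {1}/a (ge0_integral_partition P (partial_sum X n))//;
  last exact: (measurable_EFin_nat _ (fun k => `|k%:R - n.+1%:R * m| `^ p)%R).
pose x k : R := (k%:R - n%:R * m)%R.
pose g k := (`|x k| `^ p + c * (`|x k| `^ (p - 2) + 1))%R.
have g0 k : (0 <= g k)%R.
  by rewrite addr_ge0 ?powR_ge0// mulr_ge0 ?addr_ge0 ?powR_ge0// ltW.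
apply: (@le_trans _ _ (\int[P]_w (g (partial_sum X n w))%:E)).
  rewrite (ge0_integral_nat P (partial_sum X n) (fun k => (g k)%:E))//.
  apply: lee_nneseries => [k _ _|k _].
    by apply: integral_ge0 => w _; rewrite lee_fin powR_ge0.
  rewrite (eq_integral
    (fun w => (`|x k + ((X n w)%:R - m)| `^ p)%:E)); last first.
    move=> w; rewrite inE /= => Sk; congr (_ `^ _)%:E; congr `|_|%R.
    rewrite /x -Sk /partial_sum big_ord_recr/= natrD -addn1 natrD.
    by ring.
  rewrite (integral_freeze _ (X n)
    (fun j => (`|x k + (j%:R - m)| `^ p)%:E))//; last 2 first.
  - exact: measurable_nat_preimage.
  - by move=> b; rewrite iX lX.
  rewrite muleC lee_wpmul2r//.
  exact: (shifted_moment_le P xi m p M mxi p2 xi_mean xi_moment (x k)).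
rewrite -(integral_nat_affine P _ (fun k => `|x k| `^ p)%R)//; last 2 first.
- by rewrite addr_ge0// divr_ge0// ltW.
- by rewrite mulr_ge0 ?addr_ge0 ?powR_ge0// ltW.
apply: (integral_nat_le P _ g
  (fun k => (1 + c / t) * `|x k| `^ p + c * (t `^ (p / 2 - 1) + 1))%R) => //.
move=> k; rewrite g0/= /g.
have := powR_sub2_split p `|x k| t p2 (normr_ge0 _) t0.
rewrite -(ler_pM2l c_gt0); lra.
Qed.

(* Marcinkiewicz-Zygmund *)
Lemma partial_sum_moment_le : exists K : R, (0 <= K)%R /\
  forall n, a n <= (K * n%:R `^ (p / 2))%:E.
Proof.
pose q := (p / 2)%R.
have q1 : (1 <= q)%R by rewrite /q; move: p2 => p2'; lra.
have a0 : a 0%N = 0.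
  rewrite /a; under eq_integral.
    move=> w _; rewrite /partial_sum big_ord0 mul0r subr0 normr0 powR0; last first.
      by apply/eqP; move: p2 => p2'; lra.
    over.
  by rewrite integral0.
have cc := c_gt0.
have dq : (0 <= (2 * c) `^ (q - 1))%R by exact: powR_ge0.
(* With t = 2cn the recursion has factor 1 + 1/(2n), so K n^q yields the error K n^(q-1) / 2. This K
   makes the additive error at most K n^(q-1) / 2 as well; together they match the gain of
   [powR_succ_ge]. *)
pose K := (2 * (c * ((2 * c) `^ (q - 1) + 1)))%R.
have K0 : (2 * c <= K)%R.
  by rewrite /K ler_pM2l// -[leLHS]mulr1 ler_pM2l// lerDr.
exists K; split; first by lra.
elim=> [|n IH]; first by rewrite a0 lee_fin mulr_ge0 ?powR_ge0//; lra.
(* At n = 0 the choice t = 2cn is not positive; t = 1 gives the bound 2c, which is at most K. *)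
have [->|n0] := eqVneq n 0%N.
  have := partial_sum_moment_step 0 1%R ltr01.
  rewrite a0 mule0 add0e powR1 => /le_trans; apply.
  by rewrite lee_fin ?powR1 /=; lra.
move: n0; rewrite -lt0n -(ltr0n R) => n0.
have t0 : (0 < 2 * c * n%:R)%R by apply: mulr_gt0 => //; exact: mulr_gt0.
apply: le_trans (partial_sum_moment_step n _ t0) _.
apply: (@le_trans _ _ ((1 + c / (2 * c * n%:R))%:E * (K * n%:R `^ q)%:E +
    (c * ((2 * c * n%:R) `^ (p / 2 - 1) + 1))%:E)).
  by rewrite leeD2r// lee_wpmul2l// lee_fin addr_ge0// divr_ge0// ltW.
rewrite -EFinM -EFinD lee_fin -/q powRM; [|by lra|by lra].
rewrite -[in leRHS]addn1 natrD.
have H := powR_succ_ge n%:R q n0 q1.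
have n1 : (1 <= n%:R `^ (q - 1) :> R)%R.
  rewrite -[leLHS](powRr0 n%:R); apply: ler_powR; last by lra.
  by rewrite ler1n -(ltr0n R).
have K00 : (0 < K)%R by lra.
have {}H : (K * (n%:R `^ q + n%:R `^ (q - 1)) <= K * (n%:R + 1) `^ q)%R.
  by rewrite ler_pM2l.
apply: le_trans H.
have -> : ((1 + c / (2 * c * n%:R)) * (K * n%:R `^ q) =
    K * n%:R `^ q + K * n%:R `^ (q - 1) / 2)%R.
  rewrite powRB_gt0// powRr1 ?ltW//; field.
  by rewrite !gt_eqF.
have : (c * 1 <= c * n%:R `^ (q - 1))%R by rewrite ler_pM2l.
rewrite /K; lra.
Qed.

End sum_moments.

(** * Bounds for the bad events *)

Section events.
Context {d} {T : measurableType d} {R : realType} (P : probability T R).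
Local Open Scope ereal_scope.

(** Any predicate is allowed because quadruples of naturals are countable; the real comparisons in
    the bad events thus raise no measurability question. *)
Lemma measurable_nat_pred4 (f1 f2 f3 f4 : T -> nat)
    (W : nat -> nat -> nat -> nat -> Prop) :
  measurable_fun setT f1 -> measurable_fun setT f2 ->
  measurable_fun setT f3 -> measurable_fun setT f4 ->
  measurable [set w | W (f1 w) (f2 w) (f3 w) (f4 w)].
Proof.
move=> m1 m2 m3 m4.
have mb : measurable_fun setT (fun w => `[< W (f1 w) (f2 w) (f3 w) (f4 w) >]).
  apply: (measurable_nat_comp f1
    (fun k1 w => `[< W k1 (f2 w) (f3 w) (f4 w) >])) => // k1.
  apply: (measurable_nat_comp f2 (fun k2 w => `[< W k1 k2 (f3 w) (f4 w) >])) => // k2.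
  exact: (measurable_nat_comp2 f3 f4 (fun k3 k4 => `[< W k1 k2 k3 k4 >])).
rewrite (_ : mkset _ = setT `&`
  (fun w => `[< W (f1 w) (f2 w) (f3 w) (f4 w) >]) @^-1` [set true]).
  exact: mb.
by apply/seteqP; split=> w; [move=> Ww; split => //; apply/asboolP|
  move=> [_ /asboolP]].
Qed.

Lemma expectation_on_pos (f : T -> nat) (g : nat -> R) :
  expectation_on P (fun w => g (f w)) [set w | (0 < f w)%N] =
  \int[P]_w (g (f w) * (0 < f w)%N%:R)%:E.
Proof.
rewrite /expectation_on unlock; apply: eq_integral => w _.
congr (_ * _)%:E; rewrite indicE; congr (nat_of_bool _)%:R.
by apply/idP/idP; rewrite inE.
Qed.

Lemma expectation_on_posZ (f : T -> nat) (g : nat -> R) (c : R) :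
  measurable_fun setT f -> (0 <= c)%R -> (forall k, 0 <= g k)%R ->
  expectation_on P (fun w => c * g (f w))%R [set w | (0 < f w)%N] =
  c%:E * expectation_on P (fun w => g (f w)) [set w | (0 < f w)%N].
Proof.
move=> mf c0 g0; rewrite (expectation_on_pos f (fun k => c * g k)%R).
rewrite (expectation_on_pos f g) -ge0_integralZl_EFin//.
- by apply: eq_integral => w _; rewrite -EFinM mulrA.
- by move=> w _; rewrite lee_fin mulr_ge0.
- exact: (measurable_EFin_nat f (fun k => g k * (0 < k)%N%:R)%R).
Qed.

Lemma expectation_on_pos_ge0 (f : T -> nat) (g : nat -> R) :
  (forall k, 0 <= g k)%R ->
  0 <= expectation_on P (fun w => g (f w)) [set w | (0 < f w)%N].
Proof.
move=> g0; rewrite expectation_on_pos; apply: integral_ge0 => w _.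
by rewrite lee_fin mulr_ge0.
Qed.

Lemma prob_le_expectation_on (f : T -> nat) (E : set T) (g : nat -> R) :
  measurable_fun setT f -> measurable E -> (forall k, 0 <= g k)%R ->
  (forall w, E w -> (0 < f w)%N) ->
  (forall k, (0 < k)%N ->
    P (E `&` f @^-1` [set k]) <= (g k)%:E * P (f @^-1` [set k])) ->
  P E <= expectation_on P (fun w => g (f w)) [set w | (0 < f w)%N].
Proof.
move=> mf mE g0 Ef Eg; rewrite expectation_on_pos.
apply: (prob_le_integral P f E (fun k => (g k * (0 < k)%N%:R)%:E)) => //.
  by move=> k; rewrite lee_fin mulr_ge0.
case=> [|k]; last by rewrite mulr1; exact: Eg.
rewrite mulr0 mul0e (_ : _ `&` _ = set0) ?measure0//.
by apply/seteqP; split=> w // -[/Ef + /= fw]; rewrite fw.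
Qed.

Lemma prob_le_scaled_integral (E : set T) (h : T -> R) (a : R) :
  measurable E -> measurable_fun setT h -> (forall w, 0 <= h w)%R ->
  (0 <= a)%R -> (forall w, E w -> 1 <= a * h w)%R ->
  P E <= a%:E * \int[P]_w (h w)%:E.
Proof.
move=> mE mh h0 a0 Eh; rewrite -ge0_integralZl_EFin//;
  last exact/measurable_EFinP.
apply: prob_le_integral_ge1 => //.
- by apply: measurable_funeM; exact/measurable_EFinP.
- by move=> w; rewrite -EFinM lee_fin mulr_ge0.
- by move=> w _; rewrite lee_fin.
Qed.

End events.

Section process_bounds.
Context {dT dQ dM : measure_display} {R : realType}
  {T : measurableType dT} {T' : measurableType dQ} {M : measurableType dM}
  {P : probability T R} {Q : probability T' R}
  (mm : mark_maps M) (S : cbp_data P M) (G : generation_data Q M)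
  (xi : {RV Q >-> nat}).
Hypothesis hmodel : cbp_model S G xi.
Local Open Scope ereal_scope.

Definition gS (k : nat) (w : T') : nat :=
  partial_sum (goffspring G) (gN mm G k w) w.

Lemma measurable_gS k : measurable_fun setT (gS k).
Proof.
apply: (measurable_nat_comp (gN mm G k) (partial_sum (goffspring G))).
  exact: measurable_gN.
by move=> c; apply: measurable_partial_sum => j; exact: measurable_funP.
Qed.

Lemma measurable_process_event n (W : nat -> nat -> nat -> nat -> Prop) :
  measurable [set w | (0 < Xn mm S n w)%N /\
    W (Xn mm S n w) (An mm S n w) (Nn mm S n w) (Xn mm S n.+1 w)].
Proof.
apply: (measurable_nat_pred4 _ _ _ _ (fun k a c s => (0 < k)%N /\ W k a c s)).
- exact: measurable_Xn.
- exact: measurable_An.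
- exact: measurable_Nn.
- exact: measurable_Xn.
Qed.

Lemma prob_process_event n (W : nat -> nat -> nat -> nat -> Prop) (g : nat -> R) :
  (forall k, 0 <= g k)%R ->
  (forall k, (0 < k)%N ->
    Q [set w | W k (gA mm G w) (gN mm G k w) (gS k w)] <= (g k)%:E) ->
  P [set w | (0 < Xn mm S n w)%N /\
    W (Xn mm S n w) (An mm S n w) (Nn mm S n w) (Xn mm S n.+1 w)] <=
  expectation_on P (fun w => g (Xn mm S n w)) [set w | (0 < Xn mm S n w)%N].
Proof.
move=> g0 Wg; apply: prob_le_expectation_on => //.
- exact: measurable_Xn.
- exact: measurable_process_event.
- by move=> w [].
move=> k k0; have := prob_generation mm S G xi hmodel n k (W k).
rewrite (_ : _ `&` _ = [set w | (0 < Xn mm S n w)%N /\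
    W (Xn mm S n w) (An mm S n w) (Nn mm S n w) (Xn mm S n.+1 w)] `&`
    Xn mm S n @^-1` [set k]); last first.
  apply/seteqP; split=> w -[Ww Xk]; have {}Xk : Xn mm S n w = k := Xk.
    by split=> //; split; rewrite Xk.
  by split=> //; case: Ww; rewrite Xk.
by move=> ->; rewrite muleC lee_wpmul2r//; exact: Wg.
Qed.

Section moments.
Context (m p K : R).
Hypothesis sum_moment : forall n,
  \int[Q]_w (`|(partial_sum (goffspring G) n w)%:R - n%:R * m| `^ p)%:E <=
  (K * n%:R `^ (p / 2))%:E.
Hypothesis K0 : (0 <= K)%R.

(** Given N(k) = c, the sum has c independent terms. The weight u is 1 for the second bad event and
    N^(-p) on {N > 0} for the third, whose deviation is measured relative to N. *)
Lemma random_sum_moment k (u : nat -> R) : (forall c, 0 <= u c)%R ->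
  \int[Q]_w (u (gN mm G k w) *
             `|(gS k w)%:R - (gN mm G k w)%:R * m| `^ p)%:E <=
  K%:E * \int[Q]_w (u (gN mm G k w) * (gN mm G k w)%:R `^ (p / 2))%:E.
Proof.
move=> u0; have mN := measurable_gN mm G k.
have mgo j : measurable_fun setT (goffspring G j) by exact: measurable_funP.
rewrite -ge0_integralZl_EFin//; last 2 first.
- by move=> w _; rewrite lee_fin mulr_ge0 ?powR_ge0.
- exact: (measurable_EFin_nat _ (fun c => u c * c%:R `^ (p / 2))%R).
rewrite (ge0_integral_nat Q (gN mm G k)
  (fun c => K%:E * (u c * c%:R `^ (p / 2))%:E))//; last first.
  by move=> c; rewrite -EFinM lee_fin !mulr_ge0 ?powR_ge0.
rewrite (ge0_integral_partition Q (gN mm G k))//; last 2 first.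
- apply: (measurable_nat_comp (gN mm G k)
    (fun c w => (u c * `|(gS k w)%:R - c%:R * m| `^ p)%:E)) => // c.
  apply: (measurable_EFin_nat _ (fun s => u c * `|s%:R - c%:R * m| `^ p)%R).
  exact: measurable_gS.
- by move=> w; rewrite lee_fin mulr_ge0 ?powR_ge0.
apply: lee_nneseries => [c _ _|c _].
  by apply: integral_ge0 => w _; rewrite lee_fin mulr_ge0 ?powR_ge0.
rewrite (eq_integral (fun w =>
  (u c * `|(partial_sum (goffspring G) c w)%:R - c%:R * m| `^ p)%:E)); last first.
  by move=> w; rewrite inE /gS /= => ->.
have mS := measurable_partial_sum (goffspring G) c mgo.
rewrite (integral_freeze Q (partial_sum (goffspring G) c) mS _
  (partial_sum (goffspring G) c)
  (fun s => (u c * `|s%:R - c%:R * m| `^ p)%:E))//; last 3 first.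
- exact: measurable_nat_preimage.
- by move=> s; rewrite lee_fin mulr_ge0 ?powR_ge0.
- by move=> b; exact: (prob_gN_sum mm S G xi hmodel).
rewrite muleC lee_wpmul2r//.
under eq_integral do rewrite EFinM.
rewrite ge0_integralZl_EFin//;
  last exact: (measurable_EFin_nat _ (fun s => `|s%:R - c%:R * m| `^ p)%R).
by rewrite -EFinM mulrCA EFinM lee_wpmul2l// lee_fin.
Qed.

End moments.
End process_bounds.

Lemma markov_factor_ge1 {R : realType} (a b p : R) :
  0 < a -> a <= b -> 0 <= p -> 1 <= a `^ (- p) * b `^ p.
Proof.
move=> a0 ab p0; rewrite powRN ler_pdivlMl ?powR_gt0// mulr1.
by apply: ge0_ler_powR; rewrite ?nnegrE ?(ltW a0) ?(le_trans (ltW a0) ab).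
Qed.

(** The origin of the rate k^(-q): a Markov factor of order -p meets a moment of order p/2. *)
Lemma powRN_half {R : realType} (x p : R) : 0 < x ->
  x `^ (- p) * x `^ (p / 2) = x `^ (- (p / 2)).
Proof.
move=> x0; rewrite -powRD; last by rewrite (gt_eqF x0) implybT.
by congr (_ `^ _); field.
Qed.

(** * Markov bounds for one generic generation *)

Section generation_bounds.
Context {dT dQ dM : measure_display} {R : realType}
  {T : measurableType dT} {T' : measurableType dQ} {M : measurableType dM}
  {P : probability T R} {Q : probability T' R}
  (mm : mark_maps M) (S : cbp_data P M) (G : generation_data Q M)
  (xi : {RV Q >-> nat}) (m lambda p K C : R).
Hypothesis hmodel : cbp_model S G xi.
Hypotheses (m0 : 0 <= m) (p2 : 2 <= p) (K0 : 0 <= K) (C0 : 0 <= C).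
Local Open Scope ereal_scope.
Hypothesis sum_moment : forall n,
  \int[Q]_w (`|(partial_sum (goffspring G) n w)%:R - n%:R * m| `^ p)%:E <=
  (K * n%:R `^ (p / 2))%:E.

Lemma measurable_generation_event k (W : nat -> nat -> nat -> Prop) :
  measurable [set w | W (gA mm G w) (gN mm G k w) (gS mm G k w)].
Proof.
apply: (measurable_nat_pred4 (gA mm G) (gA mm G) (gN mm G k) (gS mm G k)
  (fun a _ c s => W a c s)).
- exact: measurable_gA.
- exact: measurable_gA.
- exact: measurable_gN.
- exact: measurable_gS.
Qed.

Context (k : nat) (eps : R).
Hypotheses (k0 : (0 < k)%N) (eps0 : (0 < eps)%R).
Hypothesis N_moment :
  \int[Q]_w ((gN mm G k w)%:R `^ (p / 2))%:E <= (C * k%:R `^ (p / 2))%:E.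
Hypothesis dev_moment :
  \int[Q]_w (`|(gN mm G k w)%:R - lambda * (gA mm G w)%:R * k%:R| `^ p)%:E <=
  (C * k%:R `^ (p / 2))%:E.
Hypothesis N0_prob :
  Q [set w | gN mm G k w = 0%N] <= (C * k%:R `^ (- (p / 2)))%:E.
Hypothesis N_inv_moment :
  expectation_on Q (fun w => (gN mm G k w)%:R `^ (- (p / 2)))%R
    [set w | (0 < gN mm G k w)%N] <= (C * k%:R `^ (- (p / 2)))%:E.

Let kR : (0 < k%:R :> R)%R. Proof. by rewrite ltr0n. Qed.
Let p0 : (0 <= p)%R. Proof. exact: le_trans p2. Qed.

Let mdev : measurable_fun setT
  (fun w => `|(gN mm G k w)%:R - lambda * (gA mm G w)%:R * k%:R| `^ p : R)%R.
Proof.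
exact: (measurable_nat_comp2 _ _ (fun c a =>
    `|c%:R - lambda * a%:R * k%:R| `^ p : R)%R
  (measurable_gN mm G k) (measurable_gA mm G)).
Qed.

Let msum : measurable_fun setT
  (fun w => `|(gS mm G k w)%:R - (gN mm G k w)%:R * m| `^ p : R)%R.
Proof.
exact: (measurable_nat_comp2 _ _ (fun s c => `|s%:R - c%:R * m| `^ p : R)%R
  (measurable_gS mm G k) (measurable_gN mm G k)).
Qed.

Lemma generation_event1 :
  Q [set w | (eps < `|(gN mm G k w)%:R / k%:R - lambda * (gA mm G w)%:R|)%R] <=
  (C * eps `^ (- p) * k%:R `^ (- (p / 2)))%:E.
Proof.
apply: le_trans (prob_le_scaled_integral Q _ _ ((eps * k%:R) `^ (- p))%R
    _ mdev _ _ _) _.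
- exact: (measurable_generation_event k (fun a c _ =>
    (eps < `|c%:R / k%:R - lambda * a%:R|)%R)).
- by move=> w; exact: powR_ge0.
- exact: powR_ge0.
- move=> w /= ew; apply: markov_factor_ge1 => //; first exact: mulr_gt0.
  rewrite -ler_pdivlMr// -[X in (_ / X)%R](gtr0_norm kR) -normf_div ltW//.
  by rewrite mulrBl mulfK ?gt_eqF.
apply: (@le_trans _ _ (((eps * k%:R) `^ (- p))%:E * (C * k%:R `^ (p / 2))%:E)).
  by rewrite lee_wpmul2l// lee_fin powR_ge0.
rewrite -EFinM lee_fin powRM ?(ltW eps0) ?(ltW kR)//.
by rewrite -(powRN_half _ _ kR) le_eqVlt; apply/orP; left; apply/eqP; ring.
Qed.

Lemma generation_event2 :
  Q [set w | (eps < `|(gS mm G k w)%:R / k%:R - m * lambda * (gA mm G w)%:R|)%R] <=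
  (2 `^ p * C * (K + m `^ p) * eps `^ (- p) * k%:R `^ (- (p / 2)))%:E.
Proof.
have e2 : (0 < eps * k%:R / 2)%R by rewrite divr_gt0// mulr_gt0.
apply: le_trans (prob_le_scaled_integral Q _ (fun w =>
      `|(gS mm G k w)%:R - (gN mm G k w)%:R * m| `^ p +
      m `^ p * `|(gN mm G k w)%:R - lambda * (gA mm G w)%:R * k%:R| `^ p)%R
    ((eps * k%:R / 2) `^ (- p))%R _ _ _ _ _) _.
- exact: (measurable_generation_event k (fun a _ s =>
    (eps < `|s%:R / k%:R - m * lambda * a%:R|)%R)).
- apply: measurable_funD; first exact: msum.
  by apply: measurable_funM => //; exact: mdev.
- by move=> w; rewrite addr_ge0 ?mulr_ge0 ?powR_ge0.
- exact: powR_ge0.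
- move=> w /= ew.
  set N := gN mm G k w in ew *; set s := gS mm G k w in ew *.
  set a := gA mm G w in ew *.
  (* With s the offspring total, s - m lambda a k = (s - N m) + m (N - lambda a k): offspring noise
     plus control noise. One of the two is at least half the threshold, whence the factor 2^p. *)
  have le : (eps * k%:R <= `|s%:R - N%:R * m| +
      m * `|N%:R - lambda * a%:R * k%:R|)%R.
    rewrite -[X in (X * `|_|)%R](ger0_norm m0) -normrM.
    apply: le_trans (ler_normD _ _).
    rewrite (_ : _ + _ = (s%:R / k%:R - m * lambda * a%:R) * k%:R)%R.
      by rewrite normrM (gtr0_norm kR) ler_wpM2r// ltW.
    by field; rewrite gt_eqF.
  rewrite -powRM//.
  have [l1|l1] := leP (eps * k%:R / 2)%R `|s%:R - N%:R * m|%R.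
    apply: le_trans (markov_factor_ge1 _ _ p e2 l1 p0) _.
    by rewrite ler_wpM2l ?powR_ge0// lerDl powR_ge0.
  have l2 : (eps * k%:R / 2 <= m * `|N%:R - lambda * a%:R * k%:R|)%R.
    move: le l1; lra.
  apply: le_trans (markov_factor_ge1 _ _ p e2 l2 p0) _.
  by rewrite ler_wpM2l ?powR_ge0// lerDr powR_ge0.
under eq_integral do rewrite EFinD EFinM.
rewrite ge0_integralD//; last 3 first.
- exact/measurable_EFinP.
- by move=> w _; rewrite -EFinM lee_fin mulr_ge0 ?powR_ge0.
- by apply: measurable_funeM; exact/measurable_EFinP.
rewrite ge0_integralZl_EFin ?powR_ge0//; last exact/measurable_EFinP.
have s1 := random_sum_moment mm S G xi hmodel m p K sum_moment K0 k
  (fun=> 1%R) (fun _ => ler01).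
have {s1} s2 : \int[Q]_w (`|(gS mm G k w)%:R - (gN mm G k w)%:R * m| `^ p)%:E <=
    K%:E * (C * k%:R `^ (p / 2))%:E.
  move: s1; under eq_integral do rewrite mul1r.
  under [X in _ * X]eq_integral do rewrite mul1r.
  by move/le_trans; apply; rewrite lee_wpmul2l.
apply: (@le_trans _ _ (((eps * k%:R / 2) `^ (- p))%:E *
    (K%:E * (C * k%:R `^ (p / 2))%:E + (m `^ p)%:E * (C * k%:R `^ (p / 2))%:E))).
  rewrite lee_wpmul2l ?lee_fin ?powR_ge0//; apply: leeD => //.
  by rewrite lee_wpmul2l// lee_fin powR_ge0.
rewrite -!EFinM lee_fin /= !powRM ?invr_ge0 ?mulr_ge0 ?(ltW eps0) ?(ltW kR)//.
have -> : (2^-1 `^ (- p) = 2 `^ p :> R)%R.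
  by rewrite -[in LHS](powR_inv1) // -powRrM mulN1r opprK.
by rewrite -(powRN_half _ _ kR) le_eqVlt; apply/orP; left; apply/eqP; ring.
Qed.

Lemma generation_event3 :
  Q [set w | gN mm G k w = 0%N \/ (0 < gN mm G k w)%N /\
     (eps < `|(gS mm G k w)%:R / (gN mm G k w)%:R - m|)%R] <=
  (C * (1 + K * eps `^ (- p)) * k%:R `^ (- (p / 2)))%:E.
Proof.
pose E0 := [set w | gN mm G k w = 0%N].
pose E1 := [set w | (0 < gN mm G k w)%N /\
     (eps < `|(gS mm G k w)%:R / (gN mm G k w)%:R - m|)%R].
have mE0 : measurable E0.
  exact: (measurable_generation_event k (fun _ c _ => c = 0%N)).
have mE1 : measurable E1.
  exact: (measurable_generation_event k (fun _ c s =>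
    (0 < c)%N /\ (eps < `|s%:R / c%:R - m|)%R)).
apply: (@le_trans _ _ (Q E0 + Q E1)); first exact: measureU2.
(* The threshold eps N(k) is itself random, so its factor N^(-p) stays under the integral.
   [random_sum_moment] turns it into N^(-p) N^(p/2) = N^(-p/2), the negative moment of the
   hypothesis. *)
pose u c : R := (c%:R `^ (- p) * (0 < c)%N%:R)%R.
have u0 c : (0 <= u c)%R by rewrite mulr_ge0 ?powR_ge0.
have E1le : Q E1 <= (eps `^ (- p))%:E * (K%:E * (C * k%:R `^ (- (p / 2)))%:E).
  apply: le_trans (prob_le_scaled_integral Q _ (fun w =>
      u (gN mm G k w) * `|(gS mm G k w)%:R - (gN mm G k w)%:R * m| `^ p)%R
    (eps `^ (- p))%R mE1 _ _ _ _) _.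
  - exact: (measurable_nat_comp2 _ _ (fun s c => u c * `|s%:R - c%:R * m| `^ p : R)%R
      (measurable_gS mm G k) (measurable_gN mm G k)).
  - by move=> w; rewrite mulr_ge0 ?powR_ge0.
  - exact: powR_ge0.
  - move=> w [N0 ew]; rewrite /u N0 mulr1 mulrA -powRM ?(ltW eps0)//.
    have NR : (0 < (gN mm G k w)%:R :> R)%R by rewrite ltr0n.
    apply: markov_factor_ge1 => //; first exact: mulr_gt0.
    rewrite -ler_pdivlMr// -[X in (_ / X)%R](gtr0_norm NR) -normf_div ltW//.
    by rewrite mulrBl [X in (_ - X)%R]mulrAC divff ?mul1r ?gt_eqF.
  rewrite lee_wpmul2l ?lee_fin ?powR_ge0//.
  apply: le_trans
    (random_sum_moment mm S G xi hmodel m p K sum_moment K0 k u u0) _.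
  rewrite lee_wpmul2l//; apply: le_trans N_inv_moment.
  rewrite (expectation_on_pos Q (gN mm G k) (fun c => c%:R `^ (- (p / 2)))%R).
  rewrite le_eqVlt; apply/orP; left; apply/eqP; apply: eq_integral => w _.
  rewrite /u; case: (gN mm G k w) => [|c]; first by rewrite !mulr0 mul0r.
  by rewrite !mulr1 powRN_half.
apply: (@le_trans _ _ ((C * k%:R `^ (- (p / 2)))%:E +
    (eps `^ (- p))%:E * (K%:E * (C * k%:R `^ (- (p / 2)))%:E))).
  exact: leeD.
rewrite -!EFinM -EFinD lee_fin le_eqVlt; apply/orP; left; apply/eqP; ring.
Qed.

End generation_bounds.

(** * From one generation to the process *)

Section process_events.
Context {dT dQ dM : measure_display} {R : realType}
  {T : measurableType dT} {T' : measurableType dQ} {M : measurableType dM}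
  {P : probability T R} {Q : probability T' R}
  (mm : mark_maps M) (S : cbp_data P M) (G : generation_data Q M)
  (xi : {RV Q >-> nat}) (m lambda : R).
Hypothesis hmodel : cbp_model S G xi.
Local Open Scope ereal_scope.

Lemma expectation_on_truncated_le n (b K : R) : (0 <= b)%R ->
  expectation_on P (fun w => ((Xn mm S n w)%:R <= K)%R%:R + b)%R
    [set w | (0 < Xn mm S n w)%N] <=
  P [set w | (0 < Xn mm S n w)%N /\ ((Xn mm S n w)%:R <= K)%R] + b%:E.
Proof.
move=> b0; have mXn := measurable_Xn mm S n.
rewrite (expectation_on_pos P (Xn mm S n) (fun k => (k%:R <= K)%R%:R + b)%R).
pose h k : R := (((0 < k)%N && (k%:R <= K)%R)%:R)%R.
apply: (@le_trans _ _ (\int[P]_w (1 * h (Xn mm S n w) + b)%:E)).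
  apply: (integral_nat_le P _ (fun k => ((k%:R <= K)%R%:R + b) * (0 < k)%N%:R)%R
    (fun k => 1 * h k + b)%R) => // k.
  rewrite mulr_ge0 ?addr_ge0//= /h mul1r.
  by case: ltnP => _ /=; rewrite ?mulr1 ?mulr0 ?add0r.
rewrite (integral_nat_affine P _ h)// mul1e leeD2r//.
rewrite -[X in _ <= P X]setIT -integral_indic//; last first.
  exact: (measurable_nat_pred4 (Xn mm S n) (Xn mm S n) (Xn mm S n) (Xn mm S n)
    (fun k _ _ _ => (0 < k)%N /\ (k%:R <= K)%R)).
rewrite le_eqVlt; apply/orP; left; apply/eqP; apply: eq_integral => w _.
rewrite /h indicE; congr (nat_of_bool _)%:R%:E.
by apply/idP/idP; rewrite inE => /andP.
Qed.

(** An average over N_n offspring is controlled by N_n rather than by X_n, so the slices are those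
    of N_n. *)
Lemma prob_Nn_event n (b : nat -> set nat) (g : nat -> R) : (forall c, 0 <= g c)%R ->
  (forall c, (0 < c)%N ->
    Q (partial_sum (goffspring G) c @^-1` b c) <= (g c)%:E) ->
  P [set w | (0 < Xn mm S n w)%N /\ (0 < Nn mm S n w)%N /\
             b (Nn mm S n w) (Xn mm S n.+1 w)] <=
  expectation_on P (fun w => g (Nn mm S n w)) [set w | (0 < Nn mm S n w)%N].
Proof.
move=> g0 bg; have mN := measurable_Nn mm S n.
have mE : measurable [set w | (0 < Xn mm S n w)%N /\ (0 < Nn mm S n w)%N /\
    b (Nn mm S n w) (Xn mm S n.+1 w)].
  exact: (measurable_process_event mm S n (fun _ _ c s => (0 < c)%N /\ b c s)).
apply: prob_le_expectation_on => //; first by move=> w [_ []].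
move=> c c0.
have mNc : measurable (Nn mm S n @^-1` [set c]) by exact: measurable_nat_preimage.
apply: (@le_trans _ _ (P (Nn mm S n @^-1` [set c] `&`
    partial_sum (offspring S n) c @^-1` b c))).
  apply: le_measure; rewrite ?inE.
  - exact: measurableI.
  - apply: measurableI => //; apply: measurable_nat_preimage.
    by apply: measurable_partial_sum => j; exact: measurable_funP.
  - by move=> w [[_ [_ bw]] Nc]; split => //; rewrite -Nc.
rewrite (prob_Nn_sum mm S G xi hmodel) muleC lee_wpmul2r//.
exact: bg.
Qed.

(** The two parts are bounded along different slices: extinction of the control along X_n, the
    offspring deviation along N_n. *)
Lemma event3_split n eps : P (event3 mm S m n eps) <=
  P [set w | (0 < Xn mm S n w)%N /\ Nn mm S n w = 0%N] +
  P [set w | (0 < Xn mm S n w)%N /\ (0 < Nn mm S n w)%N /\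
    (eps < `|(Xn mm S n.+1 w)%:R / (Nn mm S n w)%:R - m|)%R].
Proof.
apply: le_trans (measureU2 P _ _); last 2 first.
- exact: (measurable_process_event mm S n (fun _ _ c _ => c = 0%N)).
- exact: (measurable_process_event mm S n
    (fun _ _ c s => (0 < c)%N /\ (eps < `|s%:R / c%:R - m|)%R)).
rewrite le_eqVlt; apply/orP; left; apply/eqP; congr (P _).
apply/seteqP; split=> w; first by move=> [X0 [N0|N0]]; [left|right].
by move=> [[X0 N0]|[X0 N0]]; split => //; [left|right].
Qed.

Lemma bad_prob_le n eps (g : nat -> R) : (forall k, 0 <= g k)%R ->
  (forall k, (0 < k)%N -> [/\
    Q [set w | (eps < `|(gN mm G k w)%:R / k%:R
                        - lambda * (gA mm G w)%:R|)%R] <= (g k)%:E,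
    Q [set w | (eps < `|(gS mm G k w)%:R / k%:R
                        - m * lambda * (gA mm G w)%:R|)%R] <= (g k)%:E &
    Q [set w | gN mm G k w = 0%N \/ (0 < gN mm G k w)%N /\
               (eps < `|(gS mm G k w)%:R / (gN mm G k w)%:R - m|)%R]
      <= (g k)%:E]) ->
  bad_prob mm S m lambda n eps <= 3%:E *
    expectation_on P (fun w => g (Xn mm S n w)) [set w | (0 < Xn mm S n w)%N].
Proof.
move=> g0 Qg.
have B1 : P (event1 mm S lambda n eps) <= expectation_on P
    (fun w => g (Xn mm S n w)) [set w | (0 < Xn mm S n w)%N].
  apply: (prob_process_event mm S G xi hmodel n
    (fun k a c _ => eps < `|c%:R / k%:R - lambda * a%:R|)%R) => // k /Qg[].
  by [].
have B2 : P (event2 mm S m lambda n eps) <= expectation_on P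
    (fun w => g (Xn mm S n w)) [set w | (0 < Xn mm S n w)%N].
  apply: (prob_process_event mm S G xi hmodel n
    (fun k a _ s => eps < `|s%:R / k%:R - m * lambda * a%:R|)%R) => // k /Qg[].
  by [].
have B3 : P (event3 mm S m n eps) <= expectation_on P
    (fun w => g (Xn mm S n w)) [set w | (0 < Xn mm S n w)%N].
  apply: (prob_process_event mm S G xi hmodel n
    (fun k _ c s => c = 0%N \/ (0 < c)%N /\ (eps < `|s%:R / c%:R - m|)%R)) => // k /Qg[].
  by [].
apply: le_trans (leeD (leeD B1 B2) B3) _.
have := expectation_on_pos_ge0 P (Xn mm S n) g g0.
set e := expectation_on _ _ _ => e0.
rewrite (_ : 3 = 1 + 1 + 1 :> R)%R; last by ring.
by rewrite !EFinD !ge0_muleDl ?adde_ge0 ?lee_fin// !mul1e.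
Qed.

End process_events.

Section moment_conditions.
Context {dT dQ dM : measure_display} {R : realType}
  {T : measurableType dT} {T' : measurableType dQ} {M : measurableType dM}
  {P : probability T R} {Q : probability T' R}
  (mm : mark_maps M) (S : cbp_data P M) (G : generation_data Q M)
  (xi : {RV Q >-> nat}) (m lambda p C : R).
Hypothesis hmodel : cbp_model S G xi.
Hypothesis hm : ('E_Q[fun w => (xi w)%:R%R] = m%:E)%E.
Hypotheses (m_gt0 : 0 < m) (p2 : 2 <= p).
Hypothesis xi_moment : ('E_Q[fun w => (`|(xi w)%:R - m| `^ p)%R] < +oo)%E.
Hypothesis control_moment : forall k : nat, (1 <= k)%N ->
  ('E_Q[fun w => ((gN mm G k w)%:R `^ (p / 2))%R]
   + 'E_Q[fun w =>
       (`|(gN mm G k w)%:R - lambda * (gA mm G w)%:R * k%:R| `^ p)%R]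
   <= (C * (1 + k%:R `^ (p / 2)))%R%:E)%E /\
  (Q [set w | gN mm G k w = 0%N]
   + expectation_on Q (fun w => ((gN mm G k w)%:R `^ (- (p / 2)))%R)
       [set w | (0 < gN mm G k w)%N]
   <= (C * k%:R `^ (- (p / 2)))%R%:E)%E.
Local Open Scope ereal_scope.

(** L depends on neither k nor eps. The explicit dependence 1 + eps^(-p) is what later permits
    thresholds that vary with n. *)
Lemma generation_bad_prob : exists2 L : R, (0 <= L)%R &
  forall (eps : R) (k : nat), (0 < eps)%R -> (0 < k)%N ->
  let g := ((L * (1 + eps `^ (- p)) * k%:R `^ (- (p / 2)))%R)%:E in [/\
    Q [set w | (eps < `|(gN mm G k w)%:R / k%:R
                        - lambda * (gA mm G w)%:R|)%R] <= g,
    Q [set w | (eps < `|(gS mm G k w)%:R / k%:R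
                        - m * lambda * (gA mm G w)%:R|)%R] <= g &
    Q [set w | gN mm G k w = 0%N \/ (0 < gN mm G k w)%N /\
               (eps < `|(gS mm G k w)%:R / (gN mm G k w)%:R - m|)%R] <= g].
Proof.
have mxi : measurable_fun setT xi by exact: measurable_funP.
have moment_ge0 : 0 <= \int[Q]_w (`|(xi w)%:R - m| `^ p)%:E.
  by apply: integral_ge0 => w _; rewrite lee_fin powR_ge0.
have moment_fin : \int[Q]_w (`|(xi w)%:R - m| `^ p)%:E \is a fin_num.
  by rewrite ge0_fin_numE//; move: xi_moment; rewrite unlock.
have xi_mean : \int[Q]_w ((xi w)%:R)%:E = m%:E by rewrite -hm unlock.
have [|||||K [K0 sum_moment]] := partial_sum_moment_le Q xi (goffspring G) m p
  (fine (\int[Q]_w (`|(xi w)%:R - m| `^ p)%:E)) mxi p2 xi_mean.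
- exact: fine_ge0.
- by rewrite fineK.
- by move=> j; exact: measurable_funP.
- exact: (independent_increments_goffspring S G xi hmodel).
- exact: (goffspring_law S G xi hmodel).
have pow_ge0 (x y : R) : (0 <= x `^ y)%R by exact: powR_ge0.
have N_ge0 k : 0 <= \int[Q]_w ((gN mm G k w)%:R `^ (p / 2))%:E.
  by apply: integral_ge0 => w _; rewrite lee_fin.
have dev_ge0 k : 0 <= \int[Q]_w
    (`|(gN mm G k w)%:R - lambda * (gA mm G w)%:R * k%:R| `^ p)%:E.
  by apply: integral_ge0 => w _; rewrite lee_fin.
(* The sign of C is read off from the hypothesis at k = 1, whose left side is non-negative. *)
have C0 : (0 <= C)%R.
  have [+ _] := control_moment 1%N isT; rewrite unlock powR1 => H.
  have : 0 <= (C * (1 + 1))%:E.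
    by apply: le_trans H; rewrite adde_ge0.
  by rewrite lee_fin; lra.
have C20 : (0 <= 2 * C)%R by rewrite mulr_ge0.
(* The sum of the constants of the three generation bounds, with 2C for C because 1 + k^q <= 2 k^q
   for k >= 1. *)
exists (2 * C + 2 `^ p * (2 * C) * (K + m `^ p) + 2 * C * (1 + K))%R.
  by rewrite !addr_ge0 ?mulr_ge0 ?addr_ge0.
move=> eps k eps0 k0 /=.
have [] := control_moment k k0; rewrite unlock => H1 H2.
have kq1 : (1 <= k%:R `^ (p / 2) :> R)%R.
  rewrite -[leLHS](powRr0 k%:R); apply: ler_powR; first by rewrite ler1n.
  by rewrite divr_ge0// (le_trans _ p2).
have {}H1 : \int[Q]_w ((gN mm G k w)%:R `^ (p / 2))%:E + \int[Q]_w
    (`|(gN mm G k w)%:R - lambda * (gA mm G w)%:R * k%:R| `^ p)%:E <=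
    (2 * C * k%:R `^ (p / 2))%:E.
  apply: le_trans H1 _; rewrite lee_fin [(2 * C)%R]mulrC -mulrA ler_wpM2l//.
  lra.
have {}H2 : Q [set w | gN mm G k w = 0%N]
   + expectation_on Q (fun w => ((gN mm G k w)%:R `^ (- (p / 2)))%R)
       [set w | (0 < gN mm G k w)%N] <= (2 * C * k%:R `^ (- (p / 2)))%:E.
  apply: le_trans H2 _; rewrite lee_fin ler_wpM2r//; lra.
have inv_ge0 : 0 <= expectation_on Q
    (fun w => ((gN mm G k w)%:R `^ (- (p / 2)))%R) [set w | (0 < gN mm G k w)%N].
  exact: (expectation_on_pos_ge0 Q _ (fun c => c%:R `^ (- (p / 2)))%R).
have N_moment := le_trans (leeDl _ (dev_ge0 k)) H1.
have dev_moment := le_trans (leeDr _ (N_ge0 k)) H1.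
have N0_prob := le_trans (leeDl _ inv_ge0) H2.
have N_inv := le_trans (leeDr _ (measure_ge0 Q _)) H2.
have V0 : (0 <= eps `^ (- p))%R by [].
have Z0 : (0 <= k%:R `^ (- (p / 2)) :> R)%R by [].
have CV : (0 <= 2 * C * eps `^ (- p))%R by rewrite mulr_ge0.
have D0 : (0 <= 2 `^ p * (2 * C) * (K + m `^ p))%R.
  by rewrite !mulr_ge0 ?addr_ge0.
have DV : (0 <= 2 `^ p * (2 * C) * (K + m `^ p) * eps `^ (- p))%R.
  by rewrite mulr_ge0.
have CK : (0 <= 2 * C * K)%R by rewrite mulr_ge0.
have CKV : (0 <= 2 * C * K * eps `^ (- p))%R by rewrite mulr_ge0.
split.
- apply: le_trans (generation_event1 mm G lambda p (2 * C)%R p2 k eps k0 eps0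
    dev_moment) _.
  rewrite lee_fin; apply: ler_wpM2r => //; lra.
- apply: le_trans (generation_event2 mm S G xi m lambda p K (2 * C)%R hmodel
    (ltW m_gt0) p2 K0 sum_moment k eps k0 eps0 N_moment dev_moment) _.
  rewrite lee_fin; apply: ler_wpM2r => //; lra.
- apply: le_trans (generation_event3 mm S G xi m p K (2 * C)%R hmodel
    p2 K0 sum_moment k eps eps0 N0_prob N_inv) _.
  rewrite lee_fin; apply: ler_wpM2r => //; lra.
Qed.

End moment_conditions.

Theorem proposition2p4 (R : realType) (dT dQ dM : measure_display)
    (T : measurableType dT) (T' : measurableType dQ) (M : measurableType dM)
    (P : probability T R) (Q : probability T' R)
    (mm : mark_maps M) (S : cbp_data P M) (G : generation_data Q M)
    (xi : {RV Q >-> nat}) (m lambda : R)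
    (hmodel : cbp_model S G xi)
    (hm : ('E_Q[fun w => (xi w)%:R%R] = m%:E)%E) (m_gt0 : 0 < m)
    (lambda_gt0 : 0 < lambda) :
  (forall p q C : R, 2 <= p -> q = p / 2 ->
    ('E_Q[fun w => (`|(xi w)%:R - m| `^ p)%R] < +oo)%E ->
    (forall k : nat, (1 <= k)%N ->
      ('E_Q[fun w => ((gN mm G k w)%:R `^ q)%R]
       + 'E_Q[fun w =>
           (`|(gN mm G k w)%:R - lambda * (gA mm G w)%:R * k%:R| `^ p)%R]
       <= (C * (1 + k%:R `^ q))%R%:E)%E /\
      (Q [set w | gN mm G k w = 0%N]
       + expectation_on Q (fun w => ((gN mm G k w)%:R `^ (- q))%R)
           [set w | (0 < gN mm G k w)%N]
       <= (C * k%:R `^ (- q))%R%:E)%E) ->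
    (forall eps : R, 0 < eps -> exists Ceps : R, forall n : nat,
      (bad_prob mm S m lambda n eps
       <= Ceps%:E * expectation_on P (fun w => ((Xn mm S n w)%:R `^ (- q))%R)
            [set w | (0 < Xn mm S n w)%N])%E) /\
    (exists C' : R, forall (n : nat) (eps K : R),
      0 < eps <= 1 -> 1 <= K ->
      (bad_prob mm S m lambda n eps
       <= C'%:E * P [set w | (0 < Xn mm S n w)%N /\ ((Xn mm S n w)%:R <= K)%R]
          + (C' * eps `^ (- p) * K `^ (- q))%R%:E)%E))
  /\
  (forall eps Ceps sphi sD sxi s0 : R, 0 < eps ->
    0 < sphi < 1 -> 0 < sD < 1 -> 0 < sxi < 1 -> 0 < s0 < 1 ->
    (forall k : nat, (1 <= k)%N ->
      [/\ (Q [set w | (eps < `|(gN mm G k w)%:R / k%:R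
                               - lambda * (gA mm G w)%:R|)%R]
           <= (Ceps * sphi ^+ k)%:E)%E,
          (Q [set w | (eps * k%:R < `|gD mm G m lambda k w|)%R]
           <= (Ceps * sD ^+ k)%:E)%E,
          (Q [set w | (eps < `|k%:R^-1 * (\sum_(j < k) goffspring G j w)%:R
                               - m|)%R]
           <= (Ceps * sxi ^+ k)%:E)%E &
          (Q [set w | gN mm G k w = 0%N] <= (Ceps * s0 ^+ k)%:E)%E]) ->
    forall n : nat,
      [/\ (P (event1 mm S lambda n eps) <= Ceps%:E * Fplus mm S n sphi)%E,
          (P (event2 mm S m lambda n eps) <= Ceps%:E * Fplus mm S n sD)%E &
          (P (event3 mm S m n eps)
           <= Ceps%:E * Fplus mm S n s0 + Ceps%:E * Hplus mm S n sxi)%E]).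
Proof.
split=> [p q C p2 -> xi_moment control_moment|].
  have [L L0 HL] := generation_bad_prob mm S G xi m lambda p C hmodel hm m_gt0
    p2 xi_moment control_moment.
  split=> [eps eps0|].
    have c0 : 0 <= L * (1 + eps `^ (- p)).
      by rewrite mulr_ge0 ?addr_ge0 ?powR_ge0.
    exists (3 * (L * (1 + eps `^ (- p)))) => n.
    apply: le_trans (bad_prob_le mm S G xi m lambda hmodel n eps
      (fun k => L * (1 + eps `^ (- p)) * k%:R `^ (- (p / 2))) _ _) _.
    - by move=> k; rewrite mulr_ge0 ?powR_ge0.
    - by move=> k k0; exact: HL.
    rewrite (expectation_on_posZ P (Xn mm S n)
      (fun k => k%:R `^ (- (p / 2))))//; first by rewrite EFinM muleA.
    exact: measurable_Xn.
  (* The 3 counts the bad events; 6 = 3 * 2, where 1 + eps^(-p) <= 2 eps^(-p) for eps <= 1. *)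
  exists (3 + 6 * L) => n eps K /andP[eps0 eps1] K1.
  have K0 : 0 < K by exact: lt_le_trans K1.
  have V1 : 1 <= eps `^ (- p).
    by rewrite -(powRr0 eps); apply: ger_powR; rewrite ?eps0//; lra.
  have V0 : 0 <= eps `^ (- p) by exact: powR_ge0.
  have b0 : 0 <= 2 * L * eps `^ (- p) * K `^ (- (p / 2)).
    by rewrite !mulr_ge0 ?powR_ge0.
  (* For k <= K the trivial bound 1 is used, and for k > K the rate k^(-q) <= K^(-q); the sum of
     both serves as a single g. *)
  apply: le_trans (bad_prob_le mm S G xi m lambda hmodel n eps
    (fun k => (k%:R <= K)%R%:R + 2 * L * eps `^ (- p) * K `^ (- (p / 2))) _ _) _.
  - by move=> k; rewrite addr_ge0.
  - move=> k k0; have [H1 H2 H3] := HL eps k eps0 k0.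
    have kR : 0 < k%:R :> R by rewrite ltr0n.
    have [kK|kK] := leP k%:R K.
      have le1 (E : set T') : measurable E ->
          (Q E <= (true%:R + 2 * L * eps `^ (- p) * K `^ (- (p / 2)))%:E)%E.
        move=> mE; apply: le_trans (probability_le1 Q mE) _.
        by rewrite lee_fin lerDl.
      split; apply: le1.
      + exact: (measurable_generation_event mm G k (fun a c _ =>
          eps < `|c%:R / k%:R - lambda * a%:R|)).
      + exact: (measurable_generation_event mm G k (fun a _ s =>
          eps < `|s%:R / k%:R - m * lambda * a%:R|)).
      + exact: (measurable_generation_event mm G k (fun _ c s =>
          c = 0%N \/ (0 < c)%N /\ eps < `|s%:R / c%:R - m|)).
    have le2 : L * (1 + eps `^ (- p)) * k%:R `^ (- (p / 2)) <=
        false%:R + 2 * L * eps `^ (- p) * K `^ (- (p / 2)).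
      rewrite add0r; apply: ler_pM; rewrite ?powR_ge0//.
      + by rewrite mulr_ge0 ?addr_ge0.
      + by rewrite [2 * L]mulrC -mulrA ler_wpM2l//; lra.
      rewrite !powRN lef_pV2 ?posrE ?powR_gt0//.
      by apply: ge0_ler_powR; rewrite ?nnegrE; lra.
    by split; [apply: le_trans H1 _|apply: le_trans H2 _|apply: le_trans H3 _];
      rewrite lee_fin.
  have mA : measurable [set w | (0 < Xn mm S n w)%N /\ ((Xn mm S n w)%:R <= K)%R].
    exact: (measurable_process_event mm S n (fun k _ _ _ => (k%:R <= K)%R)).
  apply: (@le_trans _ _ (3%:E * (P [set w | (0 < Xn mm S n w)%N /\
      ((Xn mm S n w)%:R <= K)%R] +
      (2 * L * eps `^ (- p) * K `^ (- (p / 2)))%:E))%E).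
    by rewrite lee_wpmul2l//; exact: expectation_on_truncated_le.
  rewrite -(fineK (fin_num_measure P _ mA)) -EFinD -!EFinM -EFinD lee_fin.
  set a := fine _; have a0 : 0 <= a by exact: fine_ge0.
  have : 0 <= L * a by exact: mulr_ge0.
  have : 0 <= eps `^ (- p) * K `^ (- (p / 2)) by rewrite mulr_ge0 ?powR_ge0.
  lra.
move=> eps c sphi sD sxi s0 eps0 /andP[sphi0 _] /andP[sD0 _] /andP[sxi0 _]
  /andP[s00 _] H n.
(* Non-negativity of the constant follows from the first hypothesis at k = 1, since sphi > 0. *)
have c0 : 0 <= c.
  have [H1 _ _ _] := H 1%N isT; have := le_trans (measure_ge0 Q _) H1.
  by rewrite lee_fin pmulr_lge0// exprn_gt0.
have pow_ge0 s k : 0 < s -> 0 <= s ^+ k :> R.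
  by move=> ?; rewrite exprn_ge0// ltW.
have geom_ge0 s k : 0 < s -> 0 <= c * s ^+ k.
  by move=> ?; rewrite mulr_ge0// pow_ge0.
have mXn := measurable_Xn mm S n.
have mNn := measurable_Nn mm S n.
split.
- rewrite /Fplus -(expectation_on_posZ P (Xn mm S n) (fun k => sphi ^+ k))//;
    last by move=> k; exact: pow_ge0.
  apply: (prob_process_event mm S G xi hmodel n
    (fun k a b _ => eps < `|b%:R / k%:R - lambda * a%:R|)
    (fun k => c * sphi ^+ k)); first by move=> k; exact: geom_ge0.
  by move=> k /H[].
- rewrite /Fplus -(expectation_on_posZ P (Xn mm S n) (fun k => sD ^+ k))//;
    last by move=> k; exact: pow_ge0.
  apply: (prob_process_event mm S G xi hmodel n
    (fun k a _ s => eps < `|s%:R / k%:R - m * lambda * a%:R|)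
    (fun k => c * sD ^+ k)); first by move=> k; exact: geom_ge0.
  move=> k k0; have [_ + _ _] := H k k0.
  have kR : 0 < k%:R :> R by rewrite ltr0n.
  congr (_ <= _)%E; congr (Q _); apply/seteqP.
  (* The event on D(k) is the one on the ratio, multiplied through by k > 0. *)
  suff E w : (eps * k%:R < `|gD mm G m lambda k w|) =
      (eps < `|(gS mm G k w)%:R / k%:R - m * lambda * (gA mm G w)%:R|).
    by split=> w /=; rewrite E.
  rewrite (_ : _ / _ - _ = gD mm G m lambda k w / k%:R).
    by rewrite normf_div (gtr0_norm kR) ltr_pdivlMr.
  by rewrite /gD mulrBl mulfK ?gt_eqF.
apply: le_trans (event3_split mm S m n eps) _; apply: leeD.
  rewrite /Fplus -(expectation_on_posZ P (Xn mm S n) (fun k => s0 ^+ k))//;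
    last by move=> k; exact: pow_ge0.
  apply: (prob_process_event mm S G xi hmodel n (fun _ _ b _ => b = 0%N)
    (fun k => c * s0 ^+ k)); first by move=> k; exact: geom_ge0.
  by move=> k /H[].
rewrite /Hplus -(expectation_on_posZ P (Nn mm S n) (fun k => sxi ^+ k))//;
  last by move=> k; exact: pow_ge0.
apply: (prob_Nn_event mm S G xi hmodel n
  (fun b => [set s | eps < `|s%:R / b%:R - m|]) (fun k => c * sxi ^+ k)).
  by move=> k; exact: geom_ge0.
move=> k /H[_ _ + _]; congr (_ <= _)%E; congr (Q _).
by apply/seteqP; split=> w /=; rewrite mulrC.
Qed.
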